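(* Let $\sigma=\{\sigma_i\mid i\in I\}$ be a partition of the set of all primes, let $G$ be a finite $\sigma$-soluble group and let $D=G^{\mathfrak{N}_\sigma}$. Suppose that $G$ has a generalized Wielandt $\sigma$-set. Then $G$ is a $P\sigma T$-group if and only if the following conditions hold: (i) $D$ is an abelian Hall subgroup of $G$ of odd order and every element of $G$ induces a power automorphism in $D$; (ii) $G/O^{\sigma_i}(D)$ is a special $P\sigma T$-group for each $\sigma_i\in\sigma(D)$.
   Context: All groups are finite. $\sigma=\{\sigma_i\mid i\in I\}$ is a partition of the set $\mathbb{P}$ of primes. For $n\in\mathbb{N}$, $\sigma(n)=\{\sigma_i\mid \sigma_i\cap\pi(n)\ne\emptyset\}$ with $\pi(n)$ the primes dividing $n$; $\sigma(G)=\sigma(|G|)$, $\pi(G)=\pi(|G|)$. A group is $\sigma$-primary if $|\sigma(G)|\le1$, a $\sigma_i$-group if all prime divisors of its order lie in $\sigma_i$, $\sigma$-nilpotent if it is a direct product of $\sigma$-primary groups, and $\sigma$-soluble if every chief factor is $\sigma$-primary. $O^{\sigma_i}(D)$ denotes the smallest normal subgroup of $D$ whose quotient is a $\sigma_i$-group. A Hall $\sigma_i$-subgroup of $G$ is a subgroup whose order has all prime divisors in $\sigma_i$ and whose index has none in $\sigma_i$. $G^{\mathfrak{N}_\sigma}$ (the $\sigma$-nilpotent residual) is the intersection of all normal subgroups $N$ of $G$ with $G/N$ $\sigma$-nilpotent. A power automorphism of $D$ is an automorphism mapping every subgroup of $D$ onto itself; an element of $G$ induces a power automorphism in a normal subgroup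 $D$ if conjugation by it is a power automorphism of $D$. A complete Hall $\sigma$-set of $G$ is a set $\mathcal{H}$ of subgroups such that every nontrivial member is a Hall $\sigma_i$-subgroup for some $i$ and $\mathcal{H}$ contains exactly one Hall $\sigma_i$-subgroup of $G$ for each $\sigma_i\in\sigma(G)$. For a set of primes $\pi$, a group is $\pi$-supersoluble if each of its chief factors is either cyclic of prime order in $\pi$ or a $\pi'$-group. A complete Hall $\sigma$-set $\mathcal{H}$ of $G$ is a generalized Wielandt $\sigma$-set if every member of $\mathcal{H}$ is $\pi(G^{\mathfrak{N}_\sigma})$-supersoluble. $G$ is a special $P\sigma T$-group if $D_0=G^{\mathfrak{N}_\sigma}$ is contained in a Hall $\sigma_i$-subgroup $E$ of $G$ for some $i$ and: (a) $D_0$ is a Hall subgroup of $G$ and every element of $G$ induces a power automorphism in $D_0$; (b) $D_0$ has a normal complement $S$ in $E$. A subgroup $A$ is $\sigma$-quasinormal in $G$ if $G$ has a complete Hall $\sigma$-set $\mathcal{H}$ with $AH^x=H^xA$ for all $H\in\mathcal{H}$, $x\in G$. $G$ is a $P\sigma T$-group if whenever $K$ is $\sigma$-quasinormal in $H$ and $H$ is $\sigma$-quasinormal in $G$, then $K$ is $\sigma$-quasinormal in $G$. *)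

(* Defs.v *)
From mathcomp Require Import all_boot all_fingroup all_solvable.
Set Implicit Arguments.
Unset Strict Implicit.
Unset Printing Implicit Defensive.
Import GroupScope.
Local Open Scope group_scope.

(* A partition sigma = {sigma_i | i in I} of the primes is encoded by a map
   [s : nat -> nat] sending each prime p to the index i of the unique block
   sigma_i containing p (the values of s on non-primes are irrelevant). *)

Definition sigi (s : nat -> nat) (i : nat) : nat_pred := [pred p | s p == i].

Definition sig_of (s : nat -> nat) (n : nat) : seq nat := undup (map s (primes n)).

Section Defs.
Variable s : nat -> nat.

Definition sig_primary {gT : finGroupType} (B : {set gT}) : bool := size (sig_of s #|B|) <= 1.

Definition sig_nilpotent {gT : finGroupType} (B : {set gT}) : bool :=
  [exists Hs : {set {group gT}},
     [forall H in Hs, sig_primary H] &&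
     (\big[dprod/1]_(H in Hs) (gval H) == B)].

Definition sig_soluble {gT : finGroupType} (G : {group gT}) : Prop :=
  forall U V : {group gT}, chief_factor G V U -> size (sig_of s #|U : V|) <= 1.

Definition Osig {gT : finGroupType} (i : nat) (B : {set gT}) : {set gT} :=
  \bigcap_(N : {group gT} | (N <| B) && (sigi s i).-nat #|B : N|) N.

Definition sig_residual {gT : finGroupType} (B : {set gT}) : {set gT} :=
  \bigcap_(N : {group gT} | (N <| B) && sig_nilpotent (B / N)) N.

Definition complete_Hall_sig_set {gT : finGroupType} (G : {group gT}) (Hs : {set {group gT}}) : Prop :=
  (forall H : {group gT}, H \in Hs -> H :!=: 1 -> exists i, (sigi s i).-Hall(G) H) /\
  (forall i, i \in sig_of s #|G| ->
     #|[set H in Hs | (sigi s i).-Hall(G) H]| = 1%N).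

Definition pi_supersoluble {gT : finGroupType} (pi : nat_pred) (G : {group gT}) : Prop :=
  forall U V : {group gT}, chief_factor G V U ->
    (cyclic (U / V) && prime #|U : V| && (#|U : V| \in pi))
    || pi^'.-nat #|U : V|.

Definition gen_Wielandt_sig_set {gT : finGroupType} (G : {group gT}) (Hs : {set {group gT}}) : Prop :=
  complete_Hall_sig_set G Hs /\
  forall H : {group gT}, H \in Hs -> pi_supersoluble \pi(sig_residual G) H.

Definition power_aut_elt {gT : finGroupType} (x : gT) (B : {set gT}) : Prop :=
  forall H : {group gT}, H \subset B -> H :^ x = H.

Definition special_PsT {gT : finGroupType} (G : {group gT}) : Prop :=
  let D0 := sig_residual G in
  exists i, exists E : {group gT}, (sigi s i).-Hall(G) E /\ D0 \subset E /\
    (Hall G D0 /\ (forall x, x \in G -> power_aut_elt x D0)) /\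
    (exists S : {group gT}, S <| E /\ D0 :&: S = 1 /\ D0 * S = E).

Definition sig_quasinormal {gT : finGroupType} (A G : {group gT}) : Prop :=
  A \subset G /\
  exists Hs, complete_Hall_sig_set G Hs /\
    forall (H : {group gT}) x, H \in Hs -> x \in G -> A * (H :^ x) = (H :^ x) * A.

Definition PsT {gT : finGroupType} (G : {group gT}) : Prop :=
  forall K H : {group gT}, sig_quasinormal K H -> sig_quasinormal H G ->
    sig_quasinormal K G.

End Defs.

(* Main.v *)
Require Import Defs.
From mathcomp Require Import all_boot all_fingroup all_solvable.
Set Implicit Arguments.
Unset Strict Implicit.
Unset Printing Implicit Defensive.
Import GroupScope.

(** A quotient G/N is sigma-nilpotent exactly when N contains all commutators
    [x, y] of a sigma_i-element x with a sigma_i'-element y; D is the smallest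
    such N.

    If G is a PsigmaT-group and M/N is a normal sigma_i-section of G, then every
    A with N <= A <= M is sigma-quasinormal in M, hence in G; for a Hall
    sigma_j-subgroup H, j <> i, one has A = AH /\ M, so H normalises A. Thus all
    sigma_i'-elements act on M/N as power automorphisms. On chief factors below
    D these are scalars, which forces D to be nilpotent. Modulo the
    sigma_i'-part of D, let H be the normal Hall sigma_i-subgroup and p a prime
    divisor of |D|: some sigma_i'-element b moves O_p(D), so it acts without
    fixed points on a Sylow p-subgroup Q of H, whence Q = [Q, b] <= D is abelian
    and p is odd. As b centralises every element of H of order prime to |D|, a
    complement S of D in H satisfies [S, D] = 1.

    Conversely, (i) and (ii) make the sigma-quasinormal subgroups of G exactly
    those normalised by D, and this condition is seen to be transitive. *)

(** * Coprime power automorphisms *)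

(** Any preimage of [xb] can be replaced by its [pi]-part, which maps to the [pi]-part of [xb], that
    is, to [xb]. *)
Lemma quotient_pelt_lift (gT : finGroupType) (pi : nat_pred) (G N : {group gT})
    (xb : coset_of N) :
  xb \in G / N -> pi.-elt xb ->
  exists x, [/\ x \in G, x \in 'N(N), pi.-elt x & xb = coset N x].
Proof.
case/morphimP=> x nNx Gx -> pi_x; exists x.`_pi; split.
- exact: groupX.
- exact: groupX.
- exact: p_elt_constt.
by rewrite -[LHS](constt_p_elt pi_x) morph_constt.
Qed.

(** A prime outside [pi] dividing the index would give, by Cauchy, an element of that order in
    [G / N], which lifts to a [pi^']-element outside [N]. *)
Lemma normal_indexP (gT : finGroupType) (pi : nat_pred) (G N : {group gT}) :
  N <| G ->
  reflect {in G, forall x, pi^'.-elt x -> x \in N} (pi.-nat #|G : N|).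
Proof.
move=> nsNG; have [sNG nNG] := andP nsNG.
rewrite -card_quotient //; apply: (iffP idP) => [piGN x Gx pi'x | sN].
  apply: coset_idr; first exact: (subsetP nNG).
  have GNx: coset N x \in G / N by apply: mem_quotient.
  rewrite -[coset N x](constt_p_elt (mem_p_elt piGN GNx)); apply/constt1P.
  by apply: morph_p_elt; rewrite ?(subsetP nNG).
apply/pgroupP=> q q_pr qdvd; apply/negPn/negP=> pi'q.
have [xb GNx ox] := Cauchy q_pr qdvd.
have pi'x: pi^'.-elt xb by rewrite /p_elt ox pnatE.
have [x [Gx nNx pix def_x]] := quotient_pelt_lift GNx pi'x.
have:= prime_gt1 q_pr; rewrite -ox def_x coset_id ?order1 //; exact: sN.
Qed.

Lemma pelt_gen_normal (pi : nat_pred) (gT : finGroupType) (G : {group gT}) :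
  <<[set x in G | pi.-elt x]>> <| G.
Proof.
rewrite /normal gen_subG; apply/andP; split.
  by apply/subsetP=> x /setIdP[].
apply: norms_gen; apply/subsetP=> y Gy; rewrite inE.
by apply/subsetP=> _ /imsetP[x /setIdP[Gx pix] ->]; rewrite inE groupJ // p_eltJ.
Qed.

Lemma Sylow_sub_full (gT : finGroupType) (D C : {group gT}) :
    (forall p, prime p -> p %| #|D| ->
       exists2 Q : {group gT}, p.-Sylow(D) Q & Q \subset C) ->
  D \subset C.
Proof.
move=> sylC; rewrite -indexg_eq1; apply: contraT => nt1.
have p_pr: prime (pdiv #|D : C|).
  by apply: pdiv_prime; rewrite ltn_neqAle eq_sym nt1 indexg_gt0.
have [|Q sylQ sQC] := sylC _ p_pr.
  exact: dvdn_trans (pdiv_dvd _) (dvdn_indexg _ _).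
case/and3P: sylQ => _ _ /pnatP-/(_ (indexg_gt0 _ _) _ p_pr).
by rewrite !inE eqxx; apply; apply: dvdn_trans (pdiv_dvd _) (indexgS _ sQC).
Qed.

(** Let [T] be generated by the [pi]-elements. A [pi^']-element of [T] commutes with these
    generators, so [V] is a central Hall [pi^']-subgroup of [T]. Its Schur-Zassenhaus complement [K]
    is then normal and contains every generator, so [T] is a [pi]-group. *)
Lemma pcore_Hall_commute (gT : finGroupType) (pi : nat_pred) (B : {group gT}) :
    {in B &, forall x y, pi.-elt x -> pi^'.-elt y -> commute x y} ->
  pi.-Hall(B) 'O_pi(B).
Proof.
move=> cB; pose X := [set x in B | pi.-elt x]; pose T := <<X>>%G.
have nsTB: T <| B := pelt_gen_normal pi B.
have sTB := normal_sub nsTB.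
pose V := ('O_pi^'('Z(T)))%G.
have nsVT: V <| T.
  by apply: char_normal; apply: char_trans (center_char _); apply: pcore_char.
have VP: {in T, forall y, pi^'.-elt y -> y \in V}.
  move=> y Ty pi'y; have Zy: y \in 'Z(T).
    rewrite inE Ty -sub_cent1 gen_subG; apply/subsetP=> x /setIdP[Bx pix].
    apply/cent1P; apply: cB => //; exact: (subsetP sTB).
  have hall_V := nilpotent_pcore_Hall pi^' (abelian_nil (center_abelian T)).
  by rewrite /= (mem_Hall_pcore hall_V Zy).
have piTV: pi.-nat #|T : V| by apply/(normal_indexP pi nsVT).
have hallV: pi^'.-Hall(T) V.
  by rewrite /pHall normal_sub // pcore_pgroup pnatNK.
have [K /complP[tiVK defT]] := splitsP (SchurZassenhaus_split (pHall_Hall hallV) nsVT).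
have cVT: V \subset 'C(T) by apply: subset_trans (pcore_sub _ _) (subsetIr _ _).
have sKT: K \subset T by rewrite -defT mulG_subr.
have nsKT: K <| T.
  rewrite /normal sKT -defT mul_subG ?normG // cents_norm //.
  exact: subset_trans cVT (centS sKT).
have piK: pi.-group K.
  by rewrite /pgroup -(mulKn #|K| (cardG_gt0 V)) -TI_cardMg // defT divgS // normal_sub.
have hallK: pi.-Hall(T) K.
  rewrite /pHall sKT piK -divgS // -defT TI_cardMg // mulnK //; exact: pcore_pgroup.
have piT: pi.-group T.
  apply: pgroupS piK; rewrite gen_subG; apply/subsetP=> x Xx.
  rewrite (mem_normal_Hall hallK nsKT); last exact: mem_gen.
  by case/setIdP: Xx.
rewrite /pHall pcore_sub pcore_pgroup /=.
apply/(normal_indexP _ (pcore_normal _ _)) => x Bx; rewrite p_eltNK => pix.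
have sTO: T \subset 'O_pi(B) by apply: pcore_max.
by apply: (subsetP sTO); rewrite mem_gen // inE Bx.
Qed.

Lemma commg_in_cent (gT : finGroupType) (V : {group gT}) (g h : gT) :
    g \in 'N(V) -> h \in 'N(V) -> {in V, forall v, v ^ (g * h) = v ^ (h * g)} ->
  [~ g, h] \in 'C(V).
Proof.
move=> ng nh eqJ; apply/centP=> v Vv; apply: commute_sym; apply/commgP/conjg_fixP.
have ->: [~ g, h] = (h * g)^-1 * (g * h) by rewrite /commg conjgE invMg !mulgA.
by rewrite conjgM eqJ ?conjgKV // memJ_norm // groupV groupM.
Qed.

(** Automorphisms of a cyclic group are power maps, hence commute. *)
Lemma commg_norm_cycle (gT : finGroupType) (x g h : gT) :
  g \in 'N(<[x]>) -> h \in 'N(<[x]>) -> [~ g, h] \in 'C(<[x]>).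
Proof.
have powJ u: u \in 'N(<[x]>) -> exists m, x ^ u = x ^+ m.
  by move=> nu; apply/cycleP; rewrite memJ_norm // cycle_id.
move=> ng nh; have [m xg] := powJ _ ng; have [n xh] := powJ _ nh.
apply: commg_in_cent => // _ /cycleP[k ->].
rewrite !conjXg; congr (_ ^+ k).
by rewrite !conjgM xg xh !conjXg xg xh -!expgM mulnC.
Qed.

(** [A] acts trivially on [G / [~: G, A]], and under coprime action the fixed points of a quotient
    lift. *)
Lemma coprime_commG_cent (gT : finGroupType) (A G : {group gT}) :
  A \subset 'N(G) -> coprime #|G| #|A| -> solvable G -> [~: G, A] * 'C_G(A) = G.
Proof.
move=> nGA coGA solG.
have sRG: [~: G, A] \subset G by rewrite commg_subl.
have nRG: G \subset 'N([~: G, A]) by rewrite commg_norml.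
have nRA: A \subset 'N([~: G, A]) by rewrite commg_normr.
have qC := coprime_quotient_cent sRG nRA coGA solG.
have cGA: 'C_(G / [~: G, A])(A / [~: G, A]) = G / [~: G, A].
  by apply/setIidPl; rewrite quotient_cents2.
apply/eqP; rewrite eqEsubset mul_subG ?subsetIl //=.
rewrite -quotientSK //=.
by have := qC; rewrite cGA /= => ->.
Qed.

(* The cyclic group [<[x]>] cannot split as [[<[x]>, b] \x C(b)] nontrivially. *)
Lemma coprime_norm_cycle (gT : finGroupType) (p : nat) (x b : gT) :
    p.-elt x -> p^'.-elt b -> b \in 'N(<[x]>) ->
  commute x b \/ [~: <[x]>, <[b]>] = <[x]> /\ 'C_(<[x]>)[b] = 1.
Proof.
move=> px p'b nb.
have nxb: <[b]> \subset 'N(<[x]>) by rewrite cycle_subG.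
have co: coprime #|<[x]>| #|<[b]>| by rewrite (pnat_coprime px).
have abx := cycle_abelian x.
have defx := coprime_commG_cent nxb co (abelian_sol abx).
have ti := coprime_abel_cent_TI nxb co abx.
have sRx: [~: <[x]>, <[b]>] \subset <[x]> by rewrite commg_subl.
have dp: [~: <[x]>, <[b]>] \x 'C_<[x]>(<[b]>) = <[x]>.
  rewrite dprodE //; first by apply: (sub_abelian_cent2 abx); rewrite ?subsetIl.
  by rewrite setIA (setIidPl sRx).
case: (cyclic_pgroup_dprod_trivg px (cycle_cyclic x) dp) => [[_ cx] | [C1 Rx]].
  left; have: x \in 'C_<[x]>(<[b]>) by rewrite cx cycle_id.
  by rewrite cent_cycle => /setIP[_ /cent1P].
by right; split=> //; rewrite -cent_cycle.
Qed.

Lemma prime_cycle_TI (gT : finGroupType) (x y : gT) :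
  prime #[y] -> y \notin <[x]> -> <[y]> :&: <[x]> = 1.
Proof. by move=> pr_y nxy; rewrite prime_TIg // cycle_subG. Qed.

(** Serves to compare the exponents by which one power automorphism acts on [x], [y] and [x * y]. *)
Lemma TI_cycle_expM (gT : finGroupType) (x y : gT) (k l m : nat) :
    <[y]> :&: <[x]> = 1 -> commute x y ->
    x ^+ k * y ^+ l = (x * y) ^+ m -> x ^+ k = x ^+ m /\ y ^+ l = y ^+ m.
Proof.
move=> ti cxy; rewrite expgMn // => e.
have: (x ^+ m)^-1 * x ^+ k = y ^+ m * (y ^+ l)^-1.
  by apply: (canRL (mulgK _)); rewrite -mulgA e mulKg.
move=> e1; have: y ^+ m * (y ^+ l)^-1 \in <[y]> :&: <[x]>.
  by rewrite inE -{2}e1 !groupM ?groupV ?mem_cycle.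
rewrite ti => /set1P e2; split; last first.
  by symmetry; apply/eqP; rewrite eq_mulgV1 e2.
by apply/eqP; rewrite eq_sym eq_mulVg1 e1 e2.
Qed.

(** If [z] is outside [<[c]>], then [b] acts on [c], [z] and [c * z] with the same exponent modulo
    [p], which is 1 on [c]. *)
Lemma power_fix_prime (gT : finGroupType) (p : nat) (c z b : gT) :
    prime p -> #[c] = p -> #[z] = p -> commute c z -> c ^ b = c ->
    b \in 'N(<[z]>) -> b \in 'N(<[c * z]>) ->
  z ^ b = z.
Proof.
move=> p_pr oc oz cz cb nz ncz.
have [/cycleP[k ->] | ncz'] := boolP (z \in <[c]>); first by rewrite conjXg cb.
have ti: <[z]> :&: <[c]> = 1 by rewrite prime_cycle_TI ?oz.
have /cycleP[n zb]: z ^ b \in <[z]> by rewrite memJ_norm ?cycle_id.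
have /cycleP[m czb]: (c * z) ^ b \in <[c * z]> by rewrite memJ_norm ?cycle_id.
have e: c ^+ 1 * z ^+ n = (c * z) ^+ m by rewrite expg1 -czb conjMg cb zb.
have [ec ez] := TI_cycle_expM ti cz e.
rewrite zb ez -[RHS]expg1; apply/eqP; rewrite eq_expg_mod_order oz -oc.
by rewrite -eq_expg_mod_order ec.
Qed.

(** [b] acts on [V] as a scalar, and scalars commute with linear maps. For a single [v], the
    exponents of [b] on [v] and [v ^ g] agree when these are independent; otherwise [g] normalises
    [<[v]>] as well. *)
Lemma abelem_power_commute (gT : finGroupType) (p : nat) (V : {group gT}) (g b : gT) :
    prime p -> p.-abelem V -> (forall A : {group gT}, A \subset V -> b \in 'N(A)) ->
    g \in 'N(V) ->
  [~ g, b] \in 'C(V).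
Proof.
move=> p_pr abV nb ng; have [pV cVV _] := and3P abV.
apply: commg_in_cent => // [|v Vv]; first exact: nb.
have [-> | ntv] := eqVneq v 1; first by rewrite !conj1g.
have Vw: v ^ g \in V by rewrite memJ_norm.
have nbx x: x \in V -> b \in 'N(<[x]>) by move=> Vx; rewrite nb ?cycle_subG.
have [vg | nvg] := boolP (v ^ g \in <[v]>).
  have ngv: g \in 'N(<[v]>) by rewrite inE -cycleJ cycle_subG.
  rewrite [g * b]commgC conjgM; apply/conjg_fixP/commgP; apply: commute_sym.
  apply: (centP (commg_norm_cycle ngv (nbx v Vv))).
  by rewrite memJ_norm ?cycle_id // groupM ?nbx.
have ow: prime #[v ^ g] by rewrite orderJ (abelem_order_p abV).
have ti := prime_cycle_TI ow nvg.
have cvw: commute v (v ^ g) by apply: (centsP cVV).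
have /cycleP[k vb]: v ^ b \in <[v]> by rewrite memJ_norm ?cycle_id ?nbx.
have /cycleP[l wb]: (v ^ g) ^ b \in <[v ^ g]> by rewrite memJ_norm ?cycle_id ?nbx.
have /cycleP[m vwb]: (v * v ^ g) ^ b \in <[v * v ^ g]>.
  by rewrite memJ_norm ?cycle_id ?nbx // groupM.
have e: v ^+ k * (v ^ g) ^+ l = (v * v ^ g) ^+ m by rewrite -vwb conjMg vb wb.
have [ek el] := TI_cycle_expM ti cvw e.
by rewrite !conjgM vb wb conjXg el -conjXg ek conjXg.
Qed.

(** Let [z] be central of order [p]. If [b] fixes [z], it fixes every element of order [p], so it
    has fixed points in each nontrivial [<[x]>] and therefore fixes [x]. If not, it fixes no element
    of order [p], and coprime action gives the second alternative. *)
Lemma power_pgroup_coprime (gT : finGroupType) (p : nat) (Q : {group gT}) (b : gT) :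
    p.-group Q -> p^'.-elt b ->
    (forall A : {group gT}, A \subset Q -> b \in 'N(A)) ->
  Q \subset 'C[b] \/ 'C_Q[b] = 1 /\ [~: Q, <[b]>] = Q.
Proof.
move=> pQ p'b nb.
have nbx x: x \in Q -> b \in 'N(<[x]>) by move=> Qx; rewrite nb ?cycle_subG.
have [Q1 | ntQ] := eqVneq (gval Q) 1; first by left; rewrite Q1 sub1G.
have [p_pr _ _] := pgroup_pdiv pQ ntQ.
have ntZ: 'Z(Q) != 1 by rewrite center_nil_eq1 ?(pgroup_nil pQ).
have [_ pdvZ _] := pgroup_pdiv (pgroupS (center_sub Q) pQ) ntZ.
have [z /setIP[Qz cQz] oz] := Cauchy p_pr pdvZ.
have ordp (X : {group gT}): X \subset Q -> X :!=: 1 -> exists2 x, x \in X & #[x] = p.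
  move=> sXQ ntX; have [_ pdvX _] := pgroup_pdiv (pgroupS sXQ pQ) ntX.
  by have [x Xx ox] := Cauchy p_pr pdvX; exists x.
have [zb | nzb] := eqVneq (z ^ b) z.
  left; apply/subsetP=> x Qx; apply/cent1P.
  have px := mem_p_elt pQ Qx.
  have [|[_ C1]] := coprime_norm_cycle px p'b (nbx x Qx); first by [].
  have [-> | ntx] := eqVneq x 1; first exact/commute_sym/commute1.
  have [||y xy oy] := ordp <[x]>%G; rewrite ?cycle_subG ?cycle_eq1 //.
  have Qy: y \in Q by apply: subsetP xy; rewrite cycle_subG.
  have cyz: commute z y by apply: (centP cQz).
  have yb: y ^ b = y.
    by apply: (power_fix_prime p_pr oz oy cyz zb); rewrite nbx // groupM.
  have: y \in 'C_(<[x]>)[b].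
    by rewrite inE xy; apply/cent1P/commgP/conjg_fixP.
  by rewrite C1 => /set1P y1; have:= prime_gt1 p_pr; rewrite -oy y1 order1.
have C1: 'C_Q[b] = 1.
  apply/eqP; apply/idPn => ntC; case/negP: nzb; apply/eqP.
  have [||c /setIP[Qc /cent1P cb] oc] := ordp ('C_Q[b])%G; rewrite ?subsetIl //.
  have ccz: commute c z by apply: commute_sym; apply: (centP cQz).
  apply: (power_fix_prime p_pr oc oz ccz); rewrite ?nbx ?groupM //.
  exact/conjg_fixP/commgP.
right; split=> //; rewrite -{2}(@coprime_commG_cent _ <[b]>%G Q).
- by rewrite cent_cycle C1 mulg1.
- by rewrite cycle_subG nb.
- by rewrite (pnat_coprime pQ).
exact: nilpotent_sol (pgroup_nil pQ).
Qed.

(** For [p = 2], an involution is the only generator of its subgroup, so [b] would fix it. *)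
Lemma cent1_trivial_odd (gT : finGroupType) (p : nat) (Q : {group gT}) (b : gT) :
    p.-group Q -> Q :!=: 1 ->
    (forall A : {group gT}, A \subset Q -> b \in 'N(A)) ->
  'C_Q[b] = 1 -> odd p.
Proof.
move=> pQ ntQ nb C1; have [p_pr pdv _] := pgroup_pdiv pQ ntQ.
case/even_prime: (p_pr) => // p2.
have [z Qz oz] := Cauchy p_pr pdv; have:= prime_gt1 p_pr; rewrite -oz.
suff: z \in 'C_Q[b] by rewrite C1 => /set1P->; rewrite order1.
rewrite inE Qz; apply/cent1P/commgP/conjg_fixP.
have: z ^ b \in <[z]> by rewrite memJ_norm ?cycle_id ?nb ?cycle_subG.
rewrite cycle2g ?oz //; case/set2P=> // z1; move: oz.
by rewrite -(orderJ z b) z1 order1 p2.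
Qed.

(** * The sigma-nilpotent residual *)

Lemma sig_of_le1 (s : nat -> nat) (n : nat) :
  0 < n -> size (sig_of s n) <= 1 -> exists i, (sigi s i).-nat n.
Proof.
(* The default [0] matters only for [n = 1], where every block qualifies. *)
move=> n_gt0 sz; exists (head 0%N (sig_of s n)); apply/pnatP=> // p p_pr pn.
have: s p \in sig_of s n.
  by rewrite mem_undup; apply: map_f; rewrite mem_primes p_pr n_gt0.
case: (sig_of s n) sz => [|j [|//]] _ //.
by rewrite inE => /eqP<-; rewrite inE /=.
Qed.

Lemma size_sig_of_pnat (s : nat -> nat) (i n : nat) :
  (sigi s i).-nat n -> size (sig_of s n) <= 1.
Proof.
move=> pn; apply: (uniq_leq_size (undup_uniq _) (s2 := [:: i])) => j.
rewrite mem_undup => /mapP[p]; rewrite mem_primes => /and3P[p_pr n_gt0 pdv] ->.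
have: p \in sigi s i by apply: pnatPpi pn _; rewrite mem_primes p_pr n_gt0.
by rewrite !inE.
Qed.

Lemma sigi_disjoint (s : nat -> nat) (i j n : nat) :
  i != j -> (sigi s i).-nat n -> (sigi s j)^'.-nat n.
Proof.
move=> neq; apply: sub_in_pnat => p _; rewrite !inE /= => /eqP->; exact: neq.
Qed.

(** Elementwise form of sigma-nilpotency of the quotient by [N]; being a membership condition on
    commutators, it is visibly stable under intersections of the subgroups [N]. *)
Definition sig_comm (s : nat -> nat) (gT : finGroupType) (N G : {set gT}) : Prop :=
  forall i x y, x \in G -> y \in G ->
    (sigi s i).-elt x -> (sigi s i)^'.-elt y -> [~ x, y] \in N.

Lemma sig_comm1P (s : nat -> nat) (gT : finGroupType) (G : {group gT}) i :
  sig_comm s 1 G ->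
  {in G &, forall x y, (sigi s i).-elt x -> (sigi s i)^'.-elt y -> commute x y}.
Proof. by move=> cG x y Gx Gy px py; apply/commgP/eqP/set1P; apply: cG px py. Qed.

Lemma sig_comm_Hall (s : nat -> nat) (gT : finGroupType) (G : {group gT}) i :
  sig_comm s 1 G -> (sigi s i).-Hall(G) 'O_(sigi s i)(G).
Proof. by move=> cG; apply: pcore_Hall_commute => x y; apply: sig_comm1P. Qed.

Lemma sig_comm_Hall' (s : nat -> nat) (gT : finGroupType) (G : {group gT}) i :
  sig_comm s 1 G -> (sigi s i)^'.-Hall(G) 'O_(sigi s i)^'(G).
Proof.
move=> cG; apply: pcore_Hall_commute => x y Gx Gy px; rewrite p_eltNK => py.
by apply: commute_sym; apply: (sig_comm1P (i := i) cG).
Qed.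

Lemma bigdprod_pgroup (gT : finGroupType) (I : finType) (P : pred I)
    (F : I -> {group gT}) (G : {group gT}) (pi : nat_pred) :
    \big[dprod/1]_(i | P i) F i = G -> (forall i, P i -> pi.-group (F i)) ->
  pi.-group G.
Proof.
move=> /bigdprod_card defG piF; rewrite /pgroup -defG.
by apply: (big_ind (fun n => pi.-nat n)) => // m n pm pn; rewrite pnatM pm.
Qed.

(** Given a decomposition, the [sigma_i]-factors are collected in [U] and the others in [V], which
    centralise each other. Conversely, the normal Hall subgroup for the block of one prime divisor
    is split off, with induction on its complement. *)
Lemma sig_nilpotentP (s : nat -> nat) (gT : finGroupType) (G : {group gT}) :
  sig_nilpotent s G <-> sig_comm s 1 G.
Proof.
split=> [/existsP[Hs /andP[/forall_inP prim /eqP defG]] i x y Gx Gy px py | ].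
  rewrite (bigID (fun H : {group gT} => (sigi s i).-group H)) /= in defG.
  have [[U V defU defV] defG' cUV tiUV] := dprodP defG.
  rewrite defU defV in defG' cUV tiUV defG.
  have pU: (sigi s i).-group U by apply: bigdprod_pgroup defU _ => H /andP[].
  have pV: (sigi s i)^'.-group V.
    apply: bigdprod_pgroup defV _ => H /andP[HsH npH].
    have [j pj] := sig_of_le1 (cardG_gt0 H) (prim H HsH).
    by apply: (sigi_disjoint _ pj); apply: contraNneq npH => <-.
  have oG: #|G| = (#|U| * #|V|)%N by rewrite (dprod_card defG).
  have [nsUG nsVG] := dprod_normal2 defG.
  have hallU: (sigi s i).-Hall(G) U.
    rewrite /pHall normal_sub // pU -divgS ?normal_sub // oG mulKn //; exact: pV.
  have hallV: (sigi s i)^'.-Hall(G) V.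
    by rewrite /pHall normal_sub // pV -divgS ?normal_sub // oG mulnK ?pnatNK.
  rewrite inE; apply/commgP; apply/commute_sym/(centsP cUV).
    by rewrite (mem_normal_Hall hallV).
  by rewrite (mem_normal_Hall hallU).
have [n] := ubnP #|G|; elim: n => // n IHn in G * => /ltnSE-leGn cG.
have [G1 | ntG] := eqVneq (gval G) 1.
  apply/existsP; exists set0; rewrite big_set0 G1 eqxx andbT.
  by apply/forall_inP=> H; rewrite inE.
(* This choice of [i] makes [U] nontrivial, so that [V] is smaller than [G]. *)
pose i := s (pdiv #|G|); pose U := ('O_(sigi s i)(G))%G; pose V := ('O_(sigi s i)^'(G))%G.
have hallU: (sigi s i).-Hall(G) U by apply: sig_comm_Hall.
have hallV: (sigi s i)^'.-Hall(G) V by apply: sig_comm_Hall'.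
have tiUV: U :&: V = 1.
  by apply: coprime_TIg; apply: (pnat_coprime (pHall_pgroup hallU) (pHall_pgroup hallV)).
have cUV: V \subset 'C(U).
  apply/centsP=> y Vy x Ux; apply: commute_sym; apply: (sig_comm1P (i := i) cG).
  - exact: subsetP (pcore_sub _ _) _ Ux.
  - exact: subsetP (pcore_sub _ _) _ Vy.
  - exact: mem_p_elt (pHall_pgroup hallU) Ux.
  exact: mem_p_elt (pHall_pgroup hallV) Vy.
have defG: U * V = G.
  apply/eqP; rewrite eqEcard mul_subG ?pcore_sub //= TI_cardMg //.
  by rewrite (card_Hall hallU) (card_Hall hallV) partnC ?leqnn.
have ntU: U :!=: 1.
  rewrite -cardG_gt1 (cardD1 1) group1 ltnS.
  have p_pr: prime (pdiv #|G|) by rewrite pdiv_prime ?cardG_gt1.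
  have [x Gx ox] := Cauchy p_pr (pdiv_dvd _).
  apply/card_gt0P; exists x; rewrite !inE (mem_normal_Hall hallU (pcore_normal _ _)) //.
  by rewrite -order_eq1 /p_elt ox pnatE // inE /= eqxx andbT neq_ltn prime_gt1 ?orbT.
have ltVG: #|V| < #|G|.
  by rewrite -defG TI_cardMg // ltn_Pmull ?cardG_gt1.
have /existsP[Hs /andP[/forall_inP prim /eqP defV]]: sig_nilpotent s V.
  apply: IHn; first exact: leq_trans ltVG leGn.
  have sVG: V \subset G := pcore_sub _ _.
  by move=> j x y Vx Vy; apply: cG; apply: (subsetP sVG).
apply/existsP; exists (U |: Hs).
(* [Hs] is a set, so [U] contributes a factor to the product only if it is a new member. *)
have notHsU: U \notin Hs.
  apply: contra ntU => HsU; rewrite -subG1 -tiUV subsetI subxx /=.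
  by rewrite -(bigdprodWY defV) sub_gen // (bigcup_max U).
rewrite big_setU1 //= defV dprodE // defG eqxx andbT.
apply/forall_inP=> H /setU1P[-> | /prim //].
exact: size_sig_of_pnat (pHall_pgroup hallU).
Qed.

Lemma sig_nilpotent_quotient (s : nat -> nat) (gT : finGroupType) (G N : {group gT}) :
  N <| G -> sig_nilpotent s (G / N) <-> sig_comm s N G.
Proof.
move=> nsNG; have [sNG nNG] := andP nsNG; have nN := subsetP nNG.
apply: iff_trans (sig_nilpotentP s (G / N)%G) _; split=> cG i.
  move=> x y Gx Gy px py.
  apply: coset_idr; first by rewrite groupR ?nN.
  rewrite morphR ?nN //; apply/set1P; apply: (cG i).
  - exact: mem_quotient.
  - exact: mem_quotient.
  - by apply: morph_p_elt; rewrite ?nN.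
  by apply: morph_p_elt; rewrite ?nN.
move=> xb yb Gx Gy px py.
have [x [Gx' nx px' ->]] := quotient_pelt_lift Gx px.
have [y [Gy' ny py' ->]] := quotient_pelt_lift Gy py.
by rewrite -morphR //= coset_id ?group1 //; apply: (cG i).
Qed.

(** The residual is handled through its universal property, with [sig_comm] in place of
    sigma-nilpotency of the quotient. *)
Record is_residual (s : nat -> nat) (gT : finGroupType) (G D : {group gT}) : Prop :=
  IsResidual {
    res_normal : D <| G;
    res_comm : sig_comm s D G;
    res_min : forall N : {group gT}, N <| G -> sig_comm s N G -> D \subset N }.

Lemma sig_residualP (s : nat -> nat) (gT : finGroupType) (G : {group gT}) :
  exists2 D : {group gT}, sig_residual s G = D & is_residual s G D.
Proof.
pose P (N : {group gT}) := (N <| G) && sig_nilpotent s (G / N).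
exists [group of \bigcap_(N : {group gT} | P N) N] => //.
have PP N: P N <-> N <| G /\ sig_comm s N G.
  split=> [/andP[nsNG] | [nsNG]]; first by move/(sig_nilpotent_quotient s nsNG).
  by rewrite /P nsNG => /(sig_nilpotent_quotient s nsNG).
have PG: P G by apply/PP; split=> // i x y Gx Gy _ _; rewrite groupR.
split=> [|i x y Gx Gy px py|N nsNG cN] /=.
- rewrite /normal (bigcap_inf G) //=.
  by apply/norms_bigcap/bigcapsP=> N /andP[/andP[]].
- by apply/bigcapP=> N /PP[_]; apply; [exact: Gx | exact: Gy | exact: px | exact: py].
by apply: (bigcap_inf N) => //; apply/PP.
Qed.

Lemma residual_unique (s : nat -> nat) (gT : finGroupType) (G D1 D2 : {group gT}) :
  is_residual s G D1 -> is_residual s G D2 -> D1 :=: D2.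
Proof.
move=> [ns1 c1 min1] [ns2 c2 min2].
by apply/eqP; rewrite eqEsubset min1 // min2.
Qed.

(** A competitor [M] in [G / N] pulls back to a competitor [K] in [G], which contains [D]. *)
Lemma residual_quotient (s : nat -> nat) (gT : finGroupType) (G D N : {group gT}) :
  is_residual s G D -> N <| G -> is_residual s (G / N)%G (D / N)%G.
Proof.
case=> nsDG cD minD nsNG; split=> [|i xb yb Gx Gy px py|M nsMG cM].
- exact: quotient_normal.
- have [x [Gx' nx px' ->]] := quotient_pelt_lift Gx px.
  have [y [Gy' ny py' ->]] := quotient_pelt_lift Gy py.
  by rewrite -morphR //= mem_quotient //; apply: (cD i).
have [K defM sNK nsKG] := inv_quotientN nsNG nsMG.
rewrite /= defM quotientS //; apply: minD => // i x y Gx Gy px py.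
have nN := subsetP (normal_norm nsNG).
have sKN: K \subset 'N(N) by apply: subset_trans (normal_sub nsKG) (normal_norm nsNG).
rewrite -(quotientGK (normalS sNK (normal_sub nsKG) nsNG)) mem_morphpre ?groupR ?nN //.
rewrite morphR ?nN // -defM; apply: (cM i); rewrite ?mem_quotient //.
  by apply: morph_p_elt; rewrite ?nN.
by apply: morph_p_elt; rewrite ?nN.
Qed.

(** For nilpotent [D] this core has [sigma_i]-index, and a normal subgroup of [sigma_i]-index
    contains all [sigma_i']-elements. *)
Lemma Osig_pcore (s : nat -> nat) (gT : finGroupType) (D : {group gT}) (i : nat) :
  nilpotent D -> Osig s i D = 'O_(sigi s i)^'(D).
Proof.
move=> nilD; have hallW := nilpotent_pcore_Hall (sigi s i)^' nilD.
case/and3P: (hallW) => _ pW; rewrite pnatNK => iW.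
apply/eqP; rewrite eqEsubset; apply/andP; split.
  apply: (bigcap_inf ('O_(sigi s i)^'(D))%G) => //.
  by rewrite pcore_normal.
apply/bigcapsP=> N /andP[nsND iN]; apply/subsetP=> x Wx.
apply: (normal_indexP _ nsND iN); first exact: subsetP (pcore_sub _ _) x Wx.
exact: mem_p_elt Wx.
Qed.

(** * Power action on sigma-primary sections *)

Lemma mem_sig_of (s : nat -> nat) (i n : nat) :
  reflect (exists p, [/\ prime p, p %| n, 0 < n & s p = i]) (i \in sig_of s n).
Proof.
rewrite mem_undup; apply: (iffP mapP) => [[p] | [p [p_pr pn n_gt0 <-]]].
  by rewrite mem_primes => /and3P[*]; exists p.
by exists p; rewrite // mem_primes p_pr n_gt0.
Qed.

Lemma sig_of_nat (s : nat -> nat) (i j n : nat) :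
  i \in sig_of s n -> (sigi s j).-nat n -> i = j.
Proof.
case/mem_sig_of=> p [p_pr pn n_gt0 <-] /pnatP-/(_ n_gt0 p p_pr pn).
by rewrite inE /= => /eqP.
Qed.

Lemma Hall_sig_neq1 (s : nat -> nat) (gT : finGroupType) (G H : {group gT}) i :
  i \in sig_of s #|G| -> (sigi s i).-Hall(G) H -> i \in sig_of s #|H|.
Proof.
case/mem_sig_of=> p [p_pr pG _ sp] hallH; apply/mem_sig_of; exists p; split=> //.
have: p \in \pi((#|G|`_(sigi s i))%N).
  by rewrite pi_of_part // inE mem_primes p_pr pG cardG_gt0 /= inE /= sp.
by rewrite -(card_Hall hallH) mem_primes => /and3P[].
Qed.

(** The index of [H :&: M] in [M] is that of [H] in [H <*> M], a divisor of [#|G : H|]. *)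
Lemma Hall_setI_normal (pi : nat_pred) (gT : finGroupType) (G H M : {group gT}) :
  pi.-Hall(G) H -> M <| G -> pi.-Hall(M) (H :&: M).
Proof.
case/and3P=> sHG pH iH /andP[sMG nMG].
rewrite /pHall subsetIr (pgroupS (subsetIl _ _) pH) setIC indexgI /=.
rewrite -indexMg -norm_joinEl ?(subset_trans sHG) //.
by apply: pnat_dvd iH; rewrite indexSg ?joing_subl ?join_subG ?sHG.
Qed.

(** When [sigma_i] meets the primes of [#|M|], a Hall [sigma_i]-subgroup [H :&: M] is nontrivial;
    this determines the block of [H], and uniqueness in [G] applies. *)
Lemma complete_Hall_normal (s : nat -> nat) (gT : finGroupType) (G M : {group gT}) Hs :
    complete_Hall_sig_set s G Hs -> M <| G ->
  complete_Hall_sig_set s M [set (H :&: M)%G | H : {group gT} in Hs].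
Proof.
move=> [HsP uHs] nsMG; split=> [_ /imsetP[H HsH ->] ntHM | i Mi].
  have [|i hallH] := HsP H HsH.
    by apply: contraNneq ntHM => H1; rewrite /= H1 -subG1 subsetIl.
  by exists i; apply: Hall_setI_normal hallH nsMG.
have Gi: i \in sig_of s #|G|.
  have [p [p_pr pM _ sp]] := mem_sig_of _ _ _ Mi; apply/mem_sig_of.
  by exists p; split; rewrite // (dvdn_trans pM) // cardSg // normal_sub.
have /eqP/cards1P[H0 defH0] := uHs i Gi.
have: H0 \in [set H in Hs | (sigi s i).-Hall(G) H] by rewrite defH0 set11.
rewrite inE => /andP[HsH0 hallH0].
apply/eqP/cards1P; exists (H0 :&: M)%G; apply/setP=> K; rewrite !inE.
apply/andP/eqP=> [[/imsetP[H HsH ->] hallK] | ->]; last first.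
  split; last exact: Hall_setI_normal hallH0 nsMG.
  by apply/imsetP; exists H0.
have iK := Hall_sig_neq1 Mi hallK.
have [|j hallH] := HsP H HsH.
  apply: contraTneq iK => H1; rewrite /= H1.
  by have ->: 1 :&: M = 1 by [apply/trivgP; apply: subsetIl]; rewrite cards1.
have pK: (sigi s j).-group (H :&: M) := pgroupS (subsetIl _ _) (pHall_pgroup hallH).
have ij := sig_of_nat iK pK; rewrite -ij in hallH.
have: H \in [set H in Hs | (sigi s i).-Hall(G) H] by rewrite inE HsH.
by rewrite defH0 => /set1P->.
Qed.

(* The condition that the transitivity of sigma-quasinormality really gives:
   on every sigma_i-section of [G], the sigma_i'-elements of [G] act as power
   automorphisms. *)
Definition sig_power (s : nat -> nat) (gT : finGroupType) (G : {group gT}) : Prop :=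
  forall i (N M A : {group gT}) y, N <| G -> M <| G -> N \subset A -> A \subset M ->
    (sigi s i).-nat #|M : N| -> y \in G -> (sigi s i)^'.-elt y -> y \in 'N(A).

Lemma normal_quasinormal (s : nat -> nat) (gT : finGroupType) (G M : {group gT}) Hs :
  complete_Hall_sig_set s G Hs -> M <| G -> sig_quasinormal s M G.
Proof.
move=> cHs /andP[sMG nMG]; split=> //; exists Hs; split=> // H x HsH Gx.
apply: commute_sym; apply: normC.
have [H1 | ntH] := eqVneq (gval H) 1; first by rewrite H1 conjs1g sub1G.
have [i hallH] := (proj1 cHs) H HsH ntH.
apply: subset_trans nMG; rewrite -(conjGid Gx) conjSg; exact: pHall_sub hallH.
Qed.

(** A Hall [sigma_j]-subgroup lies in [N] if [j] differs from [i], and supplements [N] in [M] if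
    [j = i]. Its product with [A] is [A] or [M] accordingly. *)
Lemma primary_section_quasinormal (s : nat -> nat) (gT : finGroupType)
    (M N A : {group gT}) Hs i :
    complete_Hall_sig_set s M Hs -> N <| M -> (sigi s i).-nat #|M : N| ->
    N \subset A -> A \subset M ->
  sig_quasinormal s A M.
Proof.
move=> cHs nsNM iMN sNA sAM; split=> //; exists Hs; split=> // H x HsH Mx.
have [H1 | ntH] := eqVneq (gval H) 1; first by rewrite H1 conjs1g mulg1 mul1g.
have [j hallH] := (proj1 cHs) H HsH ntH.
have hallHx: (sigi s j).-Hall(M) (H :^ x)%G by rewrite pHallJ.
have [ij | neq_ij] := eqVneq i j; last first.
  have sHA: H :^ x \subset A.
    apply: subset_trans sNA; apply/subsetP=> y Hy.
    apply: (normal_indexP _ nsNM iMN); first exact: subsetP (pHall_sub hallHx) y Hy.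
    apply: (mem_p_elt (pi := (sigi s i)^') _ Hy).
    by apply: sigi_disjoint (pHall_pgroup hallHx); rewrite eq_sym.
  by rewrite (mulGSid sHA) (mulSGid sHA).
have defM: N * H :^ x = M.
  have nNH: H :^ x \subset 'N(N) := subset_trans (pHall_sub hallHx) (normal_norm nsNM).
  rewrite -(norm_joinEr (G := N) (H := (H :^ x)%G) nNH).
  have sXM: (N <*> H :^ x) \subset M by rewrite join_subG normal_sub //= (pHall_sub hallHx).
  apply/eqP; rewrite eqEsubset sXM -indexg_eq1 /=.
  apply/eqP; apply: (pnat_1 (pi := sigi s i)).
    by apply: pnat_dvd iMN; apply: indexgS; apply: joing_subl.
  case/and3P: hallHx => _ _; rewrite ij; apply: pnat_dvd.
  by apply: indexgS; apply: joing_subr.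
have sHM: H :^ x \subset M := pHall_sub hallHx.
have defM': H :^ x * N = M.
  by rewrite -[RHS]defM normC // (subset_trans sHM) ?normal_norm.
transitivity (gval M); last symmetry; apply/eqP; rewrite eqEsubset mul_subG //=.
  by rewrite -{1}defM mulSg.
by rewrite -{1}defM' mulgS.
Qed.

Lemma PsT_sig_power (s : nat -> nat) (gT : finGroupType) (G : {group gT}) :
  (exists Hs, complete_Hall_sig_set s G Hs) -> PsT s G -> sig_power s G.
Proof.
move=> [Hs0 cHs0] pst i N M A y nsNG nsMG sNA sAM iMN Gy py.
have [sMG nMG] := andP nsMG.
have nsNM: N <| M by apply: normalS nsNG; rewrite ?(subset_trans sNA).
have [sAG [Hs [cHs AH]]]: sig_quasinormal s A G.
  apply: pst (normal_quasinormal cHs0 nsMG).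
  exact: primary_section_quasinormal (complete_Hall_normal cHs0 nsMG) nsNM iMN sNA sAM.
(* All conjugates of the [sigma_i']-members of the Hall set: each normalises [A], and together they
   generate a subgroup containing every [sigma_i']-element. *)
pose X :=
  \bigcup_(H in [set H : {group gT} in Hs | (sigi s i)^'.-group H]) class_support H G.
have sHG H: H \in Hs -> H \subset G.
  move=> HsH; have [-> | ntH] := eqVneq (gval H) 1; first exact: sub1G.
  by have [j /pHall_sub] := (proj1 cHs) H HsH ntH.
have nsWG: <<X>> <| G.
  rewrite /normal gen_subG norms_gen; last first.
    by apply: norms_bigcup; apply/bigcapsP=> H _; apply: class_support_norm.
  rewrite andbT; apply/bigcupsP=> H; rewrite inE => /andP[HsH _].
  by rewrite class_support_subG ?sHG.
have sWN: <<X>> \subset 'N(A).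
  rewrite gen_subG; apply/bigcupsP=> H; rewrite inE => /andP[HsH pH].
  rewrite class_supportEr; apply/bigcupsP=> x Gx.
  have cAH := AH H x HsH Gx.
  have sHxG: H :^ x \subset G by rewrite -(conjGid Gx) conjSg sHG.
  have sHN: (H :^ x) :&: M \subset A.
    apply: subset_trans sNA; apply/subsetP=> z /setIP[Hz Mz].
    apply: (normal_indexP _ nsNM iMN) => //.
    by apply: (mem_p_elt (G := (H :^ x)%G)) Hz; rewrite pgroupJ.
  (* Dedekind's law; [H :^ x] normalises both terms of this intersection. *)
  have defA: (A <*> H :^ x) :&: M = A.
    by rewrite (comm_joingE (H := (H :^ x)%G)) // -group_modl // (mulGSid sHN).
  rewrite -defA normsI //; last exact: subset_trans sHxG nMG.
  by apply: subset_trans (joing_subr _ _) (normG _).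
apply: (subsetP sWN); apply: (normal_indexP (sigi s i) nsWG) => //.
(* For [p] outside [sigma_i], the member of [Hs] for the block of [p] lies in [<<X>>], so [p] cannot
   divide the index. *)
apply/pnatP=> // p p_pr pdv; apply/negPn/negP=> npi.
have pG: p %| #|G| by apply: dvdn_trans pdv (dvdn_indexg _ _).
have Gsp: s p \in sig_of s #|G| by apply/mem_sig_of; exists p.
have /eqP/cards1P[H defH] := proj2 cHs _ Gsp.
have: H \in [set H in Hs | (sigi s (s p)).-Hall(G) H] by rewrite defH set11.
rewrite inE => /andP[HsH /and3P[_ pH iH]].
have sHW: H \subset <<X>>.
  apply: sub_gen; apply: (bigcup_max H); last exact: sub_class_support.
  by rewrite inE HsH; apply: sigi_disjoint pH; rewrite inE /= in npi.
have: p \in (sigi s (s p))^'.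
  apply: (pnatP _ _ iH) => //; apply: dvdn_trans pdv _; exact: indexgS.
by rewrite !inE eqxx.
Qed.

Lemma sig_power_quotient (s : nat -> nat) (gT : finGroupType) (G K : {group gT}) :
  sig_power s G -> K <| G -> sig_power s (G / K)%G.
Proof.
move=> powG nsKG i Nb Mb Ab yb nsN nsM sNA sAM iMN Gy py.
have [sKG nKG] := andP nsKG.
have [N defN sKN nsNG] := inv_quotientN nsKG nsN.
have [M defM sKM nsMG] := inv_quotientN nsKG nsM.
have sAG: Ab \subset G / K := subset_trans sAM (normal_sub nsM).
have [A defA sKA sAG'] := inv_quotientS nsKG sAG.
have [y [Gy' ny py' ->]] := quotient_pelt_lift Gy py.
have nKX (X : {group gT}): X \subset G -> K \subset X -> K <| X.
  by move=> sXG sKX; apply: normalS nsKG.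
have [sNG sMG] := (normal_sub nsNG, normal_sub nsMG).
rewrite defA; apply: (subsetP (quotient_norm K A)); apply: mem_quotient.
apply: (powG i N M A) => //.
- by rewrite -(quotientSGK (normal_norm (nKX N sNG sKN))) // -defA -defN.
- by rewrite -(quotientSGK (normal_norm (nKX A sAG' sKA))) // -defA -defM.
have sNM: N \subset M.
  by rewrite -(quotientSGK (normal_norm (nKX N sNG sKN))) // -defN -defM (subset_trans sNA).
rewrite -(index_quotient_eq (H := K)) // -?defN -?defM //.
  exact: subset_trans (subsetIr _ _) sKN.
exact: subset_trans sMG nKG.
Qed.

(** * Nilpotency of the residual *)

Section Power.

Variables (s : nat -> nat) (gT : finGroupType).
Implicit Types (G D N R : {group gT}).

(** Of a [sigma_j]-element and a [sigma_j']-element, at least one is a [sigma_i']-element, so their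
    commutator lies in the normal subgroup that such elements generate. *)
Lemma residual_sub_gen G D i :
  is_residual s G D -> D \subset <<[set y in G | (sigi s i)^'.-elt y]>>.
Proof.
move=> [_ _ minD]; have nsY := pelt_gen_normal (sigi s i)^' G.
set Y := <<_>> in nsY *; have nYG := subsetP (normal_norm nsY).
apply: (minD (<<_>>)%G) => // j x y Gx Gy px py.
have Yy z: z \in G -> (sigi s i)^'.-elt z -> z \in Y.
  by move=> Gz pz; rewrite mem_gen // inE Gz.
have [ij | neq_ij] := eqVneq j i.
  have Yy': y \in Y by rewrite Yy -?ij.
  by rewrite commgEr groupM // memJ_norm ?nYG // groupV.
have Yx: x \in Y by rewrite Yy //; apply: sigi_disjoint neq_ij px.
by rewrite commgEl groupM ?groupV // memJ_norm ?nYG.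
Qed.

Lemma sig_power_gen G i N (M A : {group gT}) :
    sig_power s G -> N <| G -> M <| G -> N \subset A -> A \subset M ->
    (sigi s i).-nat #|M : N| ->
  <<[set y in G | (sigi s i)^'.-elt y]>> \subset 'N(A).
Proof.
move=> powG nsN nsM sNA sAM iMN; rewrite gen_subG; apply/subsetP=> y /setIdP[Gy py].
exact: (powG i N M A).
Qed.

Lemma sig_comm_quotient G N : N <| G -> sig_comm s N G -> sig_comm s 1 (G / N).
Proof.
move=> nsN cN; apply/(sig_nilpotentP s (G / N)%G).
exact/(sig_nilpotent_quotient s nsN).
Qed.

End Power.

(** Once the chief factor [V] is known to be elementary abelian, [sigma_i']-elements act on it as
    scalars. These commute with every action, so the centraliser of [V] contains all commutators
    required of a competitor to the residual. *)
Lemma residual_cent_chief (s : nat -> nat) (gT : finGroupType) (G D N R : {group gT}) :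
    sig_soluble s G -> sig_power s G -> is_residual s G D ->
    chief_factor G N R -> R \subset D ->
  [~: R, D] \subset N.
Proof.
move=> solG powG resD chRN sRD.
have [i iRN] := sig_of_le1 (indexg_gt0 _ _) (solG _ _ chRN).
have minV := chief_factor_minnormal chRN.
have [/maxgroupp/andP[/proper_sub sNR nNG] nsRG] := andP chRN.
have sRG := normal_sub nsRG.
have nsNG: N <| G by rewrite /normal nNG (subset_trans sNR).
have powQ := sig_power_quotient powG nsNG.
have resQ := residual_quotient resD nsNG.
set V := (R / N)%G in minV; set Gb := (G / N)%G in powQ resQ *.
have nsVG: V <| Gb by apply: quotient_normal.
have iV: (sigi s i).-nat #|V : [1 coset_of N]|.
  by rewrite indexg1 card_quotient // (subset_trans sRG).
have nsA (A : {group coset_of N}): A \subset V ->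
    <<[set y in Gb | (sigi s i)^'.-elt y]>> \subset 'N(A).
  by move=> sAV; apply: (sig_power_gen powQ (normal1 _) nsVG _ sAV iV); apply: sub1G.
have sVY: V \subset <<[set y in Gb | (sigi s i)^'.-elt y]>>.
  by apply: subset_trans (residual_sub_gen i resQ); apply: quotientS.
(* [V] lies in a group normalising all subgroups of [V]. Hence its commutators centralise every
   cyclic subgroup, and [V] is solvable. *)
have cV'V: [~: V, V] \subset 'C(V).
  rewrite gen_subG; apply/subsetP=> _ /imset2P[x y Vx Vy ->].
  apply/centP=> v Vv; have svV: <[v]> \subset V by rewrite cycle_subG.
  apply: (centP (commg_norm_cycle _ _)) (cycle_id v);
    by apply: subsetP (nsA <[v]>%G svV) _ _; apply: (subsetP sVY).
have solV: solvable V.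
  rewrite (series_sol (der_normal 1 V)); apply/andP; split; apply: abelian_sol.
    by apply: subset_trans cV'V (centS (der_sub 1 V)).
  exact: der_abelian 0 V.
have [_ _ /is_abelemP[p p_pr abV]] := minnormal_solvable minV (subxx _) solV.
have nbA b: b \in Gb -> (sigi s i)^'.-elt b ->
    forall A : {group coset_of N}, A \subset V -> b \in 'N(A).
  by move=> Gb_b pb A sAV; apply: (subsetP (nsA A sAV)); rewrite mem_gen // inE Gb_b.
have cDV: D / N \subset 'C_Gb(V).
  apply: (res_min resQ) => [|j x y Gx Gy px py].
    by rewrite /normal subsetIl normsI ?normG ?norms_cent ?normal_norm.
  rewrite inE groupR //=; have nV := subsetP (normal_norm nsVG).
  have [ij | neq_ij] := eqVneq j i.
    apply: (abelem_power_commute p_pr abV); last exact: nV.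
    by apply: nbA; rewrite -?ij.
  rewrite -invg_comm groupV; apply: (abelem_power_commute p_pr abV); last exact: nV.
  by apply: nbA => //; apply: sigi_disjoint neq_ij px.
rewrite -quotient_cents2 ?(subset_trans sRG) //; last first.
  exact: subset_trans (normal_sub (res_normal resD)) nNG.
by rewrite centsC; apply: subset_trans cDV (subsetIr _ _).
Qed.

(** Suppose [R] lies in [[~: R, D]], and let [U] be minimal among the normal subgroups of [G]
    between [R] and [D]. Minimality gives [[~: U, D] = U], but if [U] is nontrivial then [D]
    centralises some chief factor [U / N]. *)
Lemma residual_nilpotent (s : nat -> nat) (gT : finGroupType) (G D : {group gT}) :
  sig_soluble s G -> sig_power s G -> is_residual s G D -> nilpotent D.
Proof.
move=> solG powG resD; have nsDG := res_normal resD; have [sDG nDG] := andP nsDG.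
apply/forall_inP=> R; rewrite subsetI => /andP[sRD sRR].
have [|U /mingroupP[/and3P[nsUG sUD sRU] minU] _] :=
    @mingroup_exists _ (fun U : {group gT} => [&& U <| G, U \subset D & R \subset U]) D.
  by rewrite nsDG subxx.
have sUDU: [~: U, D] \subset U.
  by rewrite commg_subl (subset_trans sDG) ?normal_norm.
have eqU: [~: U, D] = U.
  apply: (minU [~: U, D]%G) => //; apply/and3P; split.
  - by rewrite /normal (subset_trans sUDU (normal_sub nsUG)) normsR ?normal_norm.
  - exact: subset_trans sUDU sUD.
  exact: subset_trans sRR (commSg _ sRU).
have [U1 | ntU] := eqVneq (gval U) 1; first by rewrite -subG1 -U1.
have [|N maxN _] := @maxgroup_exists _
    (fun N : {group gT} => (N \proper U) && (G \subset 'N(N))) 1%G.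
  by rewrite proper1G ntU norm1 subsetT.
have chN: chief_factor G N U by rewrite /chief_factor nsUG andbT.
have:= residual_cent_chief solG powG resD chN sUD.
rewrite eqU => sUN; have /andP[/proper_subn] := maxgroupp maxN.
by rewrite sUN.
Qed.

(** * The case of a sigma-primary residual *)

Section PrimaryResidual.

Variables (s : nat -> nat) (gT : finGroupType) (G D : {group gT}) (i : nat).
Hypotheses (powG : sig_power s G) (resD : is_residual s G D).
Hypotheses (nilD : nilpotent D) (piD : (sigi s i).-group D).

Let pi := sigi s i.
Let H := ('O_pi(G))%G.
Let Y := (<<[set y in G | pi^'.-elt y]>>)%G.
Let nsDG : D <| G := res_normal resD.
Let cQ : sig_comm s 1 (G / D) := sig_comm_quotient nsDG (res_comm resD).

(** [G / D] has a normal Hall [sigma_i]-subgroup, whose preimage is a [sigma_i]-group because [D] is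
    one. *)
Lemma primary_res_Hall : pi.-Hall(G) 'O_pi(G).
Proof.
have hallO: pi.-Hall(G / D) 'O_pi(G / D) by apply: (@sig_comm_Hall s _ (G / D)%G i).
rewrite pquotient_pcore // in hallO.
rewrite /pHall pcore_sub pcore_pgroup /=.
have sDO: D \subset 'O_pi(G) by apply: pcore_max.
case/and3P: hallO => _ _; rewrite index_quotient_eq ?pcore_sub ?normal_norm //.
exact: subset_trans (subsetIr _ _) sDO.
Qed.

Let nsHG : H <| G := pcore_normal _ _.
Let sDH : D \subset H.
Proof. exact: pcore_max. Qed.
Let sDY : D \subset Y := residual_sub_gen i resD.

Let nsA y (A : {group gT}) : A \subset H -> y \in G -> pi^'.-elt y -> y \in 'N(A).
Proof.
move=> sAH; apply: (powG (i := i) (normal1 _) nsHG (sub1G _) sAH).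
by rewrite indexg1; apply: pcore_pgroup.
Qed.

Let nYA (A : {group gT}) : A \subset H -> Y \subset 'N(A).
Proof.
by move=> sAH; rewrite gen_subG; apply/subsetP=> y /setIdP[Gy py]; apply: nsA.
Qed.

Let cHY h y : h \in H -> y \in G -> pi^'.-elt y -> [~ h, y] \in D.
Proof.
move=> Hh Gy py; apply: (res_comm resD (i := i)) => //.
  exact: subsetP (normal_sub nsHG) h Hh.
exact: mem_p_elt (pcore_pgroup _ _) Hh.
Qed.

Let nsYG : Y <| G := pelt_gen_normal _ _.
Let nsDY : D <| Y := normalS sDY (normal_sub nsYG) nsDG.

(** The generators of [Y] map into the normal Hall [sigma_i']-subgroup of [G / D]. *)
Lemma primary_res_index : pi^'.-nat #|Y : D|.
Proof.
have nDG := normal_norm nsDG.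
rewrite -card_quotient ?normal_norm //.
have hallO: pi^'.-Hall(G / D) 'O_pi^'(G / D) by apply: (@sig_comm_Hall' s _ (G / D)%G i).
apply: pgroupS (pcore_pgroup pi^' (G / D)).
rewrite sub_quotient_pre ?normal_norm // gen_subG.
apply/subsetP=> y /setIdP[Gy py]; have nDy := subsetP nDG y Gy.
rewrite mem_morphpre //= (mem_Hall_pcore hallO) ?mem_quotient //.
exact: morph_p_elt.
Qed.

Lemma primary_res_moved p :
    prime p -> p %| #|D| ->
  exists b, [/\ b \in G, pi^'.-elt b & ~~ ('O_p(D) \subset 'C[b])].
Proof.
(* Otherwise [D / N], for [N = 'O_p^'(D)], is central in [Y / N], which then is
   a sigma_i'-group, although it contains the sigma_i-group [D / N]. *)
move=> p_pr pD; pose P := [pred b | (b \in G) && pi^'.-elt b && ~~ ('O_p(D) \subset 'C[b])].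
have [/existsP[b /andP[/andP[Gb pb] nb]] | /existsPn noP] := boolP [exists b, P b].
  by exists b.
have cP b: b \in G -> pi^'.-elt b -> 'O_p(D) \subset 'C[b].
  by move=> Gb pb; have := noP b; rewrite /= Gb pb /= negbK.
pose N := ('O_p^'(D))%G.
have nsNG: N <| G by apply: char_normal_trans (pcore_char _ _) nsDG.
have nNG := normal_norm nsNG; have sYG := normal_sub nsYG.
have nNY: Y \subset 'N(N) := subset_trans sYG nNG.
have nND: D \subset 'N(N) := subset_trans sDY nNY.
have [_ defD _ _] := dprodP (nilpotent_pcoreC p nilD).
have defDN: D / N = 'O_p(D) / N by rewrite -{1}defD quotientMidr.
have cDY: Y / N \subset 'C(D / N).
  rewrite sub_quotient_pre // gen_subG; apply/subsetP=> y /setIdP[Gy py].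
  have nNy := subsetP nNG y Gy; rewrite mem_morphpre //= defDN.
  apply/centP=> _ /morphimP[d nd Pd ->]; rewrite /commute -!morphM //; congr (coset _ _).
  by apply/esym/cent1P; apply: subsetP (cP y Gy py) d Pd.
(* Since [D] has [sigma_i']-index in [Y], the [sigma_i]-elements of [Y / N] lie in [D / N], hence
   are central. *)
have hallYN: pi^'.-Hall(Y / N) 'O_pi^'(Y / N).
  apply: (@pcore_Hall_commute _ pi^' (Y / N)%G) => x y Yx Yy px; rewrite p_eltNK => py.
  have [y0 [Yy0 ny0 py0 defy]] := quotient_pelt_lift Yy py.
  have Dy0: y0 \in D.
    by apply: (normal_indexP pi^' nsDY primary_res_index) => //; rewrite p_eltNK.
  by apply: (centsP cDY) => //; rewrite defy mem_quotient.
have pYN: pi^'.-group (Y / N).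
  apply: pgroupS (pcore_pgroup pi^' (Y / N)).
  rewrite sub_quotient_pre // gen_subG; apply/subsetP=> y Yy.
  have [Gy py] := setIdP Yy; have nNy := subsetP nNG y Gy.
  rewrite mem_morphpre //= (mem_Hall_pcore hallYN) ?mem_quotient ?mem_gen //.
  exact: morph_p_elt.
have: D / N == 1.
  rewrite trivg_card1; apply/eqP; apply: (pnat_1 (pi := pi)).
    exact: quotient_pgroup.
  by apply: (pgroupS _ pYN); apply: quotientS.
rewrite -subG1 quotient_sub1 // => sDN.
have /pnatP-/(_ (cardG_gt0 _) p p_pr) := pcore_pgroup p^' D.
by rewrite (dvdn_trans pD (cardSg sDN)) !inE eqxx => /(_ isT).
Qed.

Lemma primary_res_pcore p :
    prime p -> p %| #|D| ->
  exists b, [/\ b \in G, pi^'.-elt b, p.-Sylow(G) 'O_p(D), abelian 'O_p(D)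
              & odd p /\ 'C_('O_p(D))[b] = 1].
Proof.
move=> p_pr pD; have [b [Gb pb nb]] := primary_res_moved p_pr pD.
have pip: p \in pi by apply: (pnatP _ _ piD).
have p'b: p^'.-elt b.
  by apply: sub_in_pnat pb => q _; apply: contraNneq => /= ->.
have [Q sylQ] := Sylow_exists p H.
have sQH := pHall_sub sylQ; have pQ := pHall_pgroup sylQ.
have sPQ: 'O_p(D) \subset Q.
  apply: subset_trans (pcore_sub_Hall sylQ).
  have nsDH: D <| H := normalS sDH (normal_sub nsHG) nsDG.
  by apply: pcore_max (pcore_pgroup _ _) (char_normal_trans (pcore_char _ _) nsDH).
have nbQ (A : {group gT}): A \subset Q -> b \in 'N(A).
  by move=> sAQ; apply: nsA => //; apply: subset_trans sQH.
have [cQb | [CQ defQ]] := power_pgroup_coprime pQ p'b nbQ.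
  by case/negP: nb; apply: subset_trans cQb.
(* [Q = [~: Q, <[b]>]], so facts about [Q] need checking only on commutators with powers of [b]. *)
have genQ (C : {group gT}):
    (forall x y, x \in Q -> y \in <[b]> -> [~ x, y] \in C) -> Q \subset C.
  move=> cC; rewrite -defQ gen_subG; apply/subsetP=> _ /imset2P[x y Qx by_ ->]; exact: cC.
have Gyb y: y \in <[b]> -> y \in G /\ pi^'.-elt y.
  move=> by_; split; last exact: mem_p_elt by_.
  by apply: subsetP by_; rewrite cycle_subG.
have sQD: Q \subset D.
  by apply: genQ => x y Qx /Gyb[Gy py]; apply: cHY => //; apply: subsetP sQH x Qx.
(* Here [v] lies in [D], hence in [Y], so both [v] and [y] normalise [<[x]>], and [[~ v, y]]
   centralises it. *)
have abQ: abelian Q.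
  apply/centsP=> u Qu x Qx; suff sQC: Q \subset 'C(<[x]>).
    exact: centP (subsetP sQC u Qu) x (cycle_id x).
  have sxH: <[x]> \subset H by rewrite cycle_subG (subsetP sQH).
  apply: genQ => v y Qv /Gyb[Gy py]; apply: commg_norm_cycle; last exact: nsA.
  by apply: (subsetP (nYA sxH)); apply: (subsetP sDY); apply: (subsetP sQD).
have defP: Q :=: 'O_p(D).
  apply: eq_Hall_pcore; first exact: nilpotent_pcore_Hall.
  exact: pHall_subl sQD sDH sylQ.
exists b; rewrite -defP; split=> //; first exact: subHall_Sylow primary_res_Hall pip sylQ.
split=> //; apply: (cent1_trivial_odd pQ _ nbQ CQ).
rewrite -cardG_gt1; apply: leq_trans (prime_gt1 p_pr) _; apply: dvdn_leq => //.
have sylP := nilpotent_pcore_Hall p nilD; rewrite defP (card_Hall sylP).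
by rewrite p_part -{1}[p]expn1 dvdn_exp2l // logn_gt0 mem_primes p_pr pD cardG_gt0.
Qed.

Lemma primary_res_abelian : abelian D.
Proof.
suff: D \subset 'Z(D) by move=> sDZ; apply: subset_trans sDZ (subsetIr _ _).
apply: (Sylow_sub_full (C := 'Z(D)%G)) => p p_pr pD.
have [b [_ _ _ abP _]] := primary_res_pcore p_pr pD.
exists ('O_p(D))%G; first exact: nilpotent_pcore_Hall.
have [_ defD cPP _] := dprodP (nilpotent_pcoreC p nilD).
have cD: 'O_p(D) \subset 'C('O_p(D) * 'O_p^'(D)).
  by rewrite centM subsetI; apply/andP; split=> //; rewrite centsC.
by rewrite subsetI pcore_sub; rewrite defD in cD.
Qed.

Lemma primary_res_isHall : Hall G D.
Proof.
rewrite /Hall normal_sub //= coprime_pi' //; apply/pnatP=> // p p_pr pdv.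
rewrite !inE; apply/negP; rewrite mem_primes => /and3P[_ _ pD].
have [b [_ _ sylP _ _]] := primary_res_pcore p_pr pD.
case/and3P: sylP => _ _ /pnatP-/(_ (indexg_gt0 _ _) p p_pr).
rewrite !inE eqxx => nd.
by have //:= nd (dvdn_trans pdv (indexgS G (pcore_sub p D))).
Qed.

Lemma primary_res_odd : odd #|D|.
Proof.
apply: contraT; rewrite -[odd _]negbK -dvdn2 negbK => D2.
by have [b [_ _ _ _ []]] := primary_res_pcore (isT : prime 2) D2.
Qed.

(** For [h] in a complement [S] and [d] in ['O_p(D)], both [h] and [h ^ d] generate subgroups
    meeting [D] trivially, so [b] centralises both. Then [[~ h, d]] is a fixed point of [b] in
    ['O_p(D)], hence trivial. *)
Lemma primary_res_compl :
  exists S : {group gT}, [/\ S <| H, D :&: S = 1, D * S = H & S \subset 'C(D)].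
Proof.
have sHG := normal_sub nsHG.
have nsDH: D <| H := normalS sDH sHG nsDG.
have hallD: Hall H D.
  have /andP[_ coD] := primary_res_isHall; rewrite /Hall sDH.
  exact: coprime_dvdr (indexSg sDH sHG) coD.
have [S /complP[tiDS defH]] := splitsP (SchurZassenhaus_split hallD nsDH).
have sSH: S \subset H by rewrite -defH mulG_subr.
have cb h b: h \in H -> <[h]> :&: D = 1 -> b \in G -> pi^'.-elt b -> [~ h, b] = 1.
  move=> Hh ti Gb pb; suff: [~ h, b] \in <[h]> :&: D by rewrite ti => /set1P.
  rewrite inE cHY // andbT.
  have nhb: b \in 'N(<[h]>) by rewrite nsA ?cycle_subG.
  by rewrite commgEl groupM ?groupV ?cycle_id // memJ_norm ?cycle_id.
have cDS: D \subset 'C(S).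
  apply: (Sylow_sub_full (C := 'C(S)%G)) => p p_pr pD.
  exists ('O_p(D))%G; first exact: nilpotent_pcore_Hall.
  have [b [Gb pb _ _ [_ C1]]] := primary_res_pcore p_pr pD.
  apply/centsP=> d Pd h Sh; apply: commute_sym; apply/commgP.
  suff: [~ h, d] \in 'C_('O_p(D))[b] by rewrite C1 inE.
  have Hh := subsetP sSH h Sh; have Dd := subsetP (pcore_sub _ _) d Pd.
  have Hd := subsetP sDH d Dd.
  have tih: <[h]> :&: D = 1.
    by apply/trivgP; rewrite /= setIC -tiDS setIS // cycle_subG.
  have tihd: <[h ^ d]> :&: D = 1.
    by rewrite cycleJ -{1}(conjGid Dd) -conjIg tih conjs1g.
  rewrite inE; apply/andP; split.
    have nPH: H \subset 'N('O_p(D)).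
      exact: normal_norm (char_normal_trans (pcore_char _ _) nsDH).
    by rewrite commgEr groupM // memJ_norm ?groupV // (subsetP nPH).
  rewrite commgEl groupM ?groupV //; apply/cent1P; apply/commgP/eqP; apply: cb => //.
  by rewrite groupJ.
exists S; split=> //; last by rewrite centsC.
by rewrite /normal sSH -defH mul_subG ?normG // cents_norm.
Qed.

(** The [sigma_i']-part of [x] normalises [A] by the power condition; the [sigma_i]-part lies in
    [H = D * S], which centralises [D]. *)
Lemma primary_res_power x (A : {group gT}) : x \in G -> A \subset D -> x \in 'N(A).
Proof.
move=> Gx sAD; rewrite -(consttC pi x) groupM //; last first.
  by apply: nsA; rewrite ?groupX ?p_elt_constt // (subset_trans sAD).
have Hx: x.`_pi \in H.
  by rewrite (mem_Hall_pcore primary_res_Hall) ?groupX ?p_elt_constt.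
have [S [_ _ defH cDS]] := primary_res_compl.
have cDH: H \subset 'C(D) by rewrite -defH mul_subG //; apply: primary_res_abelian.
by apply: (subsetP (cent_sub A)); apply: (subsetP (centS sAD)); apply: (subsetP cDH).
Qed.

Lemma primary_res_special : special_PsT s G.
Proof.
have [D1 eqD res1] := sig_residualP s G.
rewrite /special_PsT eqD -(residual_unique resD res1); exists i, H.
split; first exact: primary_res_Hall.
split=> //; split; first split; first exact: primary_res_isHall.
  by move=> x Gx A sAD; apply/normP; apply: primary_res_power.
by have [S [nsSH ti defH _]] := primary_res_compl; exists S.
Qed.

End PrimaryResidual.

(** * From primary quotients to the whole residual *)

Lemma pcore_sig_p' (s : nat -> nat) (gT : finGroupType) (D : {group gT}) (p : nat) :
  p^'.-group 'O_(sigi s (s p))^'(D).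
Proof.
by apply: sub_in_pnat (pcore_pgroup _ _) => q _; apply: contraNneq => /= ->; rewrite inE /=.
Qed.

Lemma dvdn_quotient_pcore (s : nat -> nat) (gT : finGroupType) (D : {group gT}) (p : nat) :
  prime p -> p %| #|D| -> p %| #|D / 'O_(sigi s (s p))^'(D)|.
Proof.
move=> p_pr pD; rewrite card_quotient ?normal_norm ?pcore_normal //.
move: pD; rewrite -(Lagrange (pcore_sub (sigi s (s p))^' D)) Euclid_dvdM //.
case/orP=> // pW; have /pnatP-/(_ (cardG_gt0 _) p p_pr pW) := pcore_sig_p' s D p.
by rewrite !inE eqxx.
Qed.

Section Structure.

Variables (s : nat -> nat) (gT : finGroupType) (G D : {group gT}).
Hypotheses (powG : sig_power s G) (resD : is_residual s G D) (nilD : nilpotent D).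

(** Factoring out [W i] leaves the [sigma_i]-part of the residual, where the primary case applies.
    For a prime [p], the choice [i = s p] preserves [p]-elements, as [W (s p)] is a [p']-group. *)
Let W i := ('O_(sigi s i)^'(D))%G.
Let nsDG : D <| G := res_normal resD.

Let nsWG i : W i <| G.
Proof. exact: char_normal_trans (pcore_char _ _) nsDG. Qed.

Let powQ i : sig_power s (G / W i)%G := sig_power_quotient powG (nsWG i).
Let resQ i : is_residual s (G / W i)%G (D / W i)%G := residual_quotient resD (nsWG i).
Let nilQ i : nilpotent (D / W i)%G := quotient_nil _ nilD.

Let piQ i : (sigi s i).-group (D / W i)%G.
Proof.
have /and3P[_ _] := nilpotent_pcore_Hall (sigi s i)^' nilD.
by rewrite pnatNK /pgroup card_quotient // normal_norm ?pcore_normal.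
Qed.

Let p'W (p : nat) : p^'.-group (W (s p)) := pcore_sig_p' s D p.

Let pDW (p : nat) : prime p -> p %| #|D| -> p %| #|D / W (s p)|.
Proof. exact: dvdn_quotient_pcore. Qed.

Lemma residual_abelian : abelian D.
Proof.
rewrite abelianE; apply/commG1P/trivgP.
(* No such [p] exists, as [[~: D, D]] lies in the [p']-group [W (s p)]. *)
apply: (Sylow_sub_full (D := [~: D, D]%G) (C := 1%G)) => p p_pr pD.
have abQ := primary_res_abelian (@powQ (s p)) (resQ (s p)) (nilQ (s p)) (piQ (s p)).
have nWD: D \subset 'N(W (s p)) by rewrite normal_norm ?pcore_normal.
have sDW: [~: D, D] \subset W (s p) by rewrite -quotient_cents2.
have /pnatP-/(_ (cardG_gt0 _) p p_pr (dvdn_trans pD (cardSg sDW))) := p'W p.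
by rewrite !inE eqxx.
Qed.

Lemma residual_Hall : Hall G D.
Proof.
rewrite /Hall normal_sub //= coprime_pi' //; apply/pnatP=> // p p_pr pdv.
rewrite !inE; apply/negP; rewrite mem_primes => /and3P[_ _ pD].
have /andP[_] := primary_res_isHall (@powQ (s p)) (resQ (s p)) (nilQ (s p)) (piQ (s p)).
have nWG := normal_norm (nsWG (s p)).
rewrite /= index_quotient_eq ?(normal_sub nsDG) //; last first.
  by apply: subset_trans (subsetIr _ _) (pcore_sub _ _).
move/(coprime_dvdr pdv)/(coprime_dvdl (pDW p_pr pD)).
by rewrite /coprime gcdnn => /eqP p1; rewrite p1 in p_pr.
Qed.

Lemma residual_odd : odd #|D|.
Proof.
apply: contraT; rewrite -[odd _]negbK -dvdn2 negbK => D2.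
have := primary_res_odd (@powQ (s 2)) (resQ (s 2)) (nilQ (s 2)) (piQ (s 2)).
by rewrite -[odd _]negbK -dvdn2 (pDW (p := 2)).
Qed.

(** Modulo [W (s p)], [x] normalises [A]. So a [p]-element of [A :^ x] is [w * a], with [w] a
    [p']-element commuting with [a] in [A], and it equals the [p]-part of [a]. *)
Lemma residual_power x : x \in G -> power_aut_elt x D.
Proof.
move=> Gx A sAD; apply/eqP; rewrite eqEcard cardJg leqnn andbT.
apply: (Sylow_sub_full (D := (A :^ x)%G)) => p p_pr _.
have [Q sylQ] := Sylow_exists p (A :^ x)%G; exists Q => //.
have nWG := normal_norm (nsWG (s p)).
have nWD: D \subset 'N(W (s p)) := subset_trans (normal_sub nsDG) nWG.
have nWA := subset_trans sAD nWD.
have xbN: coset (W (s p)) x \in 'N(A / W (s p)).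
  have GWx: coset (W (s p)) x \in G / W (s p) by apply: mem_quotient.
  exact: (primary_res_power (@powQ (s p)) (resQ (s p)) (nilQ (s p)) (piQ (s p)) GWx
           (quotientS _ sAD)).
have sAW: A :^ x \subset W (s p) * A.
  have nWx: x \in 'N(W (s p)) := subsetP nWG x Gx.
  have nWAx: A :^ x \subset 'N(W (s p)) by rewrite -(conjGid nWx) conjSg.
  by rewrite -quotientSK // quotientJ // (normP xbN).
apply/subsetP=> q Qq; have pq := mem_p_elt (pHall_pgroup sylQ) Qq.
have /mulsgP[w a Ww Aa defq] := subsetP sAW q (subsetP (pHall_sub sylQ) q Qq).
have cwa: commute w a.
  apply: (centsP residual_abelian); first exact: subsetP (pcore_sub _ _) w Ww.
  exact: subsetP sAD a Aa.
rewrite -(constt_p_elt pq) defq consttM // (_ : w.`_p = 1) ?mul1g ?groupX //.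
by apply/constt1P; apply: mem_p_elt (p'W p) Ww.
Qed.

Lemma residual_special i : special_PsT s (G / Osig s i D)%G.
Proof.
rewrite Osig_pcore //.
exact: primary_res_special (@powQ i) (resQ i) (nilQ i) (piQ i).
Qed.

End Structure.

(** * The converse *)

(** The normal complement [S] and the abelian group [D / W] both centralise [D / W], hence so does
    [E], and then every [sigma_i]-element for [i = s p]. Thus [[~ x, d]] lies in the [p']-group [W],
    and by the power condition also in [<[d]>]. *)
Lemma special_cent (s : nat -> nat) (gT : finGroupType) (G D : {group gT}) p x d :
    is_residual s G D -> abelian D -> {in G, forall y, power_aut_elt y D} ->
    (forall i, i \in sig_of s #|D| -> special_PsT s (G / Osig s i D)%G) ->
    prime p -> d \in D -> p.-elt d -> x \in G -> (sigi s (s p)).-elt x ->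
  commute x d.
Proof.
move=> resD abD powD spD p_pr Dd pd Gx px.
have [-> | ntd] := eqVneq d 1; first exact: commute1.
have pD: p %| #|D|.
  apply: dvdn_trans (order_dvdG Dd).
  have ntd': <[d]> != 1 by rewrite cycle_eq1.
  by have [] := pgroup_pdiv (G := <[d]>%G) pd ntd'.
have Di: s p \in sig_of s #|D| by apply/mem_sig_of; exists p.
have := spD _ Di; rewrite Osig_pcore ?abelian_nil //.
set W := ('O_(sigi s (s p))^'(D))%G.
have nsDG := res_normal resD.
have nsWG: W <| G := char_normal_trans (pcore_char _ _) nsDG.
have nW := subsetP (normal_norm nsWG).
have [D1 defD1 res1] := sig_residualP s (G / W)%G.
have resQ := residual_quotient resD nsWG.
rewrite /special_PsT defD1 -(residual_unique resQ res1) /=.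
case=> j [E [hallE [sDE [_ [S [nsSE [tiDS defE]]]]]]].
(* [p] divides the order of [D / W], which lies in the [sigma_j]-group [E]. *)
have ij: s p = j.
  apply: (sig_of_nat (n := #|D / W|) _ (pgroupS sDE (pHall_pgroup hallE))).
  by apply/mem_sig_of; exists p; split=> //; apply: dvdn_quotient_pcore.
have nsDQ: D / W <| G / W by apply: quotient_normal.
have sEG := pHall_sub hallE.
have cSD: S \subset 'C(D / W).
  have nDS: S \subset 'N(D / W).
    exact: subset_trans (normal_sub nsSE) (subset_trans sEG (normal_norm nsDQ)).
  have nSD: D / W \subset 'N(S) := subset_trans sDE (normal_norm nsSE).
  rewrite centsC; apply/commG1P/trivgP; rewrite /= -tiDS subsetI.
  by rewrite commg_subl nDS commg_subr nSD.
have cED: E \subset 'C(D / W) by rewrite -defE mul_subG //; apply: quotient_abelian.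
pose C := 'C_(G / W)(D / W)%G.
have nsC: C <| (G / W)%G.
  by rewrite /normal subsetIl normsI ?normG ?norms_cent ?normal_norm.
have Cx: coset W x \in C.
  apply: (normal_indexP (sigi s j)^' nsC) => //; last 1 first.
  - by rewrite p_eltNK -ij; apply: morph_p_elt; rewrite ?nW.
  - case/and3P: hallE => _ _; apply: pnat_dvd; apply: indexgS.
    by rewrite subsetI sEG.
  exact: mem_quotient.
have Gd: d \in G := subsetP (normal_sub nsDG) d Dd.
have Wxd: [~ x, d] \in W.
  apply: coset_idr; rewrite ?groupR ?nW // morphR ?nW //=.
  apply/eqP/commgP; case/setIP: Cx => _ /centP; apply; exact: mem_quotient.
have dxd: [~ x, d] \in <[d]>.
  have nd: x \in 'N(<[d]>) by apply/normP; apply: powD; rewrite ?cycle_subG.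
  by rewrite commgEr groupM ?cycle_id // memJ_norm // groupV cycle_id.
have ti: <[d]> :&: W = 1.
  by apply: coprime_TIg; apply: (pnat_coprime (pi := p)) pd (pcore_sig_p' s D p).
apply/commgP; suff: [~ x, d] \in <[d]> :&: W by rewrite ti inE.
by rewrite inE dxd.
Qed.

(** Modulo [E] the group [A] lies in the image of [H], and ['O_pi(E)] lies in [H], so [A] lies in
    [V * H]. Then [A] and [K] are complements of [V] in [V <*> A], conjugate under [V] by
    Schur-Zassenhaus. *)
Lemma sig_Hall_dominates (s : nat -> nat) (gT : finGroupType) (X E H A : {group gT}) j :
    abelian E -> E <| X -> sig_comm s E X -> (sigi s j).-Hall(X) H ->
    A \subset X -> (sigi s j).-group A ->
  exists2 x, x \in E & A \subset H :^ x.
Proof.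
set pi := sigi s j => abE nsEX cE hallH sAX pA.
have [sEX nEX] := andP nsEX; have sHX := pHall_sub hallH.
have hallO: pi.-Hall(X / E) 'O_pi(X / E).
  by apply: (@sig_comm_Hall s _ (X / E)%G j); apply: sig_comm_quotient.
have defHE: H / E = 'O_pi(X / E).
  apply: (eq_Hall_pcore (H := (H / E)%G) hallO).
  by apply: quotient_pHall; rewrite ?(subset_trans sHX).
have sAEH: A \subset E * H.
  rewrite -quotientSK ?(subset_trans sAX) // defHE.
  by rewrite (sub_Hall_pcore (K := (A / E)%G) hallO) ?quotientS ?quotient_pgroup.
pose V := ('O_pi^'(E))%G.
have nsVX: V <| X := char_normal_trans (pcore_char _ _) nsEX.
have nVX := normal_norm nsVX.
have [nVH nVA] := (subset_trans sHX nVX, subset_trans sAX nVX).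
have sOH: 'O_pi(E) \subset H.
  apply: subset_trans (pcore_sub_Hall hallH).
  exact: pcore_max (pcore_pgroup _ _) (char_normal_trans (pcore_char _ _) nsEX).
have sAVH: A \subset V * H.
  apply: subset_trans sAEH _.
  have [_ defE cOV _] := dprodP (nilpotent_pcoreC pi (abelian_nil abE)).
  by rewrite -{1}defE -(centC cOV) -mulgA mulgS // mulSGid.
pose K := (H :&: (V <*> A))%G.
have defVA: V * K = V <*> A.
  have sVA: V <*> A \subset V <*> H.
    by rewrite join_subG joing_subl /= norm_joinEr.
  by rewrite group_modl ?joing_subl // -norm_joinEr // (setIidPr sVA).
have p'V: pi^'.-group V := pcore_pgroup _ _.
have pK: pi.-group K := pgroupS (subsetIl _ _) (pHall_pgroup hallH).
have coVK: coprime #|V| #|K| by rewrite coprime_sym (pnat_coprime pK).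
have coVA: coprime #|V| #|A| by rewrite coprime_sym (pnat_coprime pA).
have oKA: #|A| = #|K|.
  apply/eqP; rewrite -(eqn_pmul2l (cardG_gt0 V)) -!coprime_cardMg //.
  by rewrite defVA norm_joinEr.
have nVK: K \subset 'N(V) := subset_trans (subsetIl _ _) nVH.
have solV: solvable V by apply: abelian_sol; apply: abelianS abE; apply: pcore_sub.
have sAVK: A \subset V * K by rewrite defVA joing_subr.
have [x Vx defA] := SchurZassenhaus_trans_sol solV nVK sAVK coVK oKA.
exists x; first exact: subsetP (pcore_sub _ _) x Vx.
by rewrite defA conjSg subsetIl.
Qed.

Lemma pelt_norm (gT : finGroupType) (A : {group gT}) d :
    (forall p a, prime p -> a \in A -> p.-elt a -> a ^ d \in A) -> d \in 'N(A).
Proof.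
move=> nA; rewrite inE; apply: (Sylow_sub_full (D := (A :^ d)%G)) => p p_pr _.
have [Q sylQ] := Sylow_exists p (A :^ d)%G; exists Q => //; apply/subsetP=> u Qu.
have /imsetP[a Aa def_u] := subsetP (pHall_sub sylQ) u Qu.
rewrite def_u (nA p) // -(p_eltJ _ _ d) -def_u; exact: mem_p_elt (pHall_pgroup sylQ) Qu.
Qed.

(** * Quasinormality as normalisation by the residual *)

Section Converse.

Variables (s : nat -> nat) (gT : finGroupType) (G D : {group gT}).
Hypotheses (nsDG : D <| G) (cD : sig_comm s D G) (abD : abelian D) (hallD : Hall G D).
Hypothesis powD : {in G, forall x (A : {group gT}), A \subset D -> x \in 'N(A)}.
Hypothesis centD : forall p x d, prime p -> d \in D -> p.-elt d -> x \in G ->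
  (sigi s (s p)).-elt x -> commute x d.

Let pelt_sig (p : nat) (x : gT) : p.-elt x -> (sigi s (s p)).-elt x.
Proof. by apply: sub_in_pnat => q _; rewrite !inE => /eqP->. Qed.

(* If [a \in A] lies in a Hall subgroup [H] permuting with [A], then [[~ a, d]]
   lies in [A * H :^ d], whose index over [A] is prime to [p]. *)
Lemma quasinormal_norm (X A : {group gT}) (p : nat) d :
    X \subset G -> sig_quasinormal s A X -> prime p -> d \in X -> d \in D -> p.-elt d ->
  d \in 'N(A).
Proof.
move=> sXG [sAX [Hs [cHs permA]]] p_pr Xd Dd pd; apply: pelt_norm => q a q_pr Aa qa.
have [Xa Ga] : a \in X /\ a \in G.
  by have Xa := subsetP sAX a Aa; split=> //; apply: subsetP sXG a Xa.
have nda: a \in 'N(<[d]>) by rewrite powD ?cycle_subG.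
have [sqp | neq] := eqVneq (s q) (s p).
  have cad: commute a d by apply: centD Dd pd Ga _; rewrite -?sqp //; apply: pelt_sig.
  by have /commgP/conjg_fixP-> := cad.
have [-> | nta] := eqVneq a 1; first by rewrite conj1g.
have Xq: s q \in sig_of s #|X|.
  apply/mem_sig_of; exists q; split=> //; apply: dvdn_trans (order_dvdG Xa).
  have nta': <[a]> != 1 by rewrite cycle_eq1.
  by have [] := pgroup_pdiv (G := <[a]>%G) qa nta'.
have /eqP/cards1P[H defH] := proj2 cHs _ Xq.
have: H \in [set H in Hs | (sigi s (s q)).-Hall(X) H] by rewrite defH set11.
rewrite inE => /andP[HsH hallH].
have [||||||x /setIP[Xx _] sax] := @sig_Hall_dominates s _ X (X :&: D)%G H <[a]>%G (s q).
- exact: abelianS (subsetIr _ _) abD.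
- exact: normalGI sXG nsDG.
- move=> j u v Xu Xv pu pv; rewrite inE groupR //.
  by apply: cD pu pv; apply: (subsetP sXG).
- exact: hallH.
- by rewrite cycle_subG.
- exact: pelt_sig.
(* This conjugate contains [a ^ d], and it permutes with [A] because [x * d] lies in [X]. *)
pose K := (H :^ (x * d))%G.
have cAK: commute A K by apply: permA; rewrite ?groupM.
have Kad: a ^ d \in K by rewrite /= conjsgM memJ_conjg; apply: subsetP sax _ (cycle_id a).
pose T := ((A <*> K) :&: <[d]>)%G.
have Tad: [~ a, d] \in T.
  rewrite inE; apply/andP; split.
    rewrite commgEl; apply: groupM; last exact: subsetP (joing_subr A K) _ Kad.
    by rewrite groupV; apply: subsetP (joing_subl A K) a Aa.
  by rewrite commgEr groupM ?cycle_id // memJ_norm // groupV cycle_id.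
have nTA: A \subset 'N(T).
  rewrite normsI //; first exact: subset_trans (joing_subl A K) (normG _).
  by apply/subsetP=> u Au; rewrite powD ?cycle_subG // (subsetP sXG) ?(subsetP sAX).
(* The index of [A] in [A <*> T] is a power of [p], and it divides [#|A <*> K : A|], which divides
   [#|K|] and is prime to [p]. *)
have sTA: T \subset A.
  rewrite -indexg_eq1; apply/eqP; apply: (pnat_1 (pi := p)).
    by apply: pnat_dvd (dvdn_indexg _ _) _; apply: pgroupS (subsetIr _ _) pd.
  rewrite -indexMg -norm_joinEl //.
  have: #|A <*> T : A| %| #|A <*> K : A|.
    by rewrite indexSg ?joing_subl // join_subG joing_subl subsetIl.
  move/pnat_dvd; apply; rewrite comm_joingE // indexMg.
  apply: pnat_dvd (dvdn_indexg _ _) _; rewrite /= cardJg.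
  apply: sub_in_pnat (pHall_pgroup hallH) => r _; rewrite !inE => /eqP sr.
  by apply: contraNneq neq => <-; rewrite sr.
by rewrite -(mulKVg a (a ^ d)) -commgEl groupM // (subsetP sTA).
Qed.

(* An element [k] of [K] not commuting with [d] acts on [<[d]>] without fixed
   points, so that [<[d]> = [~: <[d]>, <[k]>]] already lies in [H]. *)
Lemma quasinormal_trans_norm (K H : {group gT}) (p : nat) d :
    sig_quasinormal s K H -> sig_quasinormal s H G ->
    prime p -> d \in D -> p.-elt d ->
  d \in 'N(K).
Proof.
move=> qK qH p_pr Dd pd; have [sKH _] := qK; have [sHG _] := qH.
have Gd: d \in G := subsetP (normal_sub nsDG) d Dd.
have nHd: d \in 'N(H) := quasinormal_norm (subxx _) qH p_pr Gd Dd pd.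
apply: pelt_norm => q k q_pr Kk qk.
have Hk := subsetP sKH k Kk; have Gk := subsetP sHG k Hk.
have fixk: commute k d -> k ^ d \in K by move=> ckd; have /commgP/conjg_fixP-> := ckd.
have [sqp | neq] := eqVneq (s q) (s p).
  by apply: fixk; apply: centD Dd pd Gk _; rewrite -?sqp //; apply: pelt_sig.
have p'k: p^'.-elt k.
  apply: sub_in_pnat qk => r _; rewrite !inE => /eqP->.
  by apply: contraNneq neq => ->.
have ndk: k \in 'N(<[d]>) by rewrite powD ?cycle_subG.
have [cdk | [defd _]] := coprime_norm_cycle pd p'k ndk; first exact/fixk/commute_sym.
have Hd: d \in H.
  rewrite -cycle_subG -defd; apply: (subset_trans (commgS _ (_ : <[k]> \subset H))).
    by rewrite cycle_subG.
  by rewrite commg_subr cycle_subG.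
by rewrite memJ_norm //; apply: (quasinormal_norm sHG qK p_pr Hd Dd pd).
Qed.

(** With [R = K :&: D] normal in [G], replacing [P] by [R <*> P] changes neither product with [K],
    so it suffices that [K] normalises [R <*> P]. This is checked on elements [k] of prime power
    order. *)
Lemma norm_quasinormal (K : {group gT}) Hs :
    complete_Hall_sig_set s G Hs -> K \subset G -> D \subset 'N(K) ->
  sig_quasinormal s K G.
Proof.
move=> cHs sKG nKD; split=> //; exists Hs; split=> // H x HsH Gx.
have [H1 | ntH] := eqVneq (gval H) 1; first by rewrite H1 conjs1g mulg1 mul1g.
have [j hallH] := (proj1 cHs) H HsH ntH.
pose P := (H :^ x)%G; have hallP: (sigi s j).-Hall(G) P by rewrite pHallJ.
have sPG := pHall_sub hallP; pose R := (K :&: D)%G.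
have nR: {in G, forall y, y \in 'N(R)} by move=> y Gy; rewrite powD ?subsetIr.
have nRP: P \subset 'N(R) by apply/subsetP=> y Py; rewrite nR ?(subsetP sPG).
suff nRPK: K \subset 'N(R <*> P).
  have defKP: K * P = K * (R <*> P).
    by rewrite norm_joinEr // mulgA (mulGSid (subsetIl K D)).
  have defPK: P * K = (R <*> P) * K.
    by rewrite norm_joinEr // -(normC nRP) -mulgA (mulSGid (subsetIl K D)).
  by rewrite -[H :^ x]/(gval P) defKP defPK; apply: normC.
apply: Sylow_sub_full => q q_pr _; have [Q sylQ] := Sylow_exists q K.
exists Q => //; apply/subsetP=> k Qk; have qk := mem_p_elt (pHall_pgroup sylQ) Qk.
have Kk := subsetP (pHall_sub sylQ) k Qk; have Gk := subsetP sKG k Kk.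
have [Dq | nDq] := boolP (q \in \pi(D)).
  have Dk: k \in D.
    rewrite (mem_normal_Hall (Hall_pi hallD) nsDG Gk).
    by apply: sub_in_pnat qk => r _; rewrite !inE => /eqP->.
  by apply: (subsetP (normG _)); apply: (subsetP (joing_subl _ _)); rewrite inE Kk.
have [||d Dd sPd] := @sig_Hall_dominates s _ G D P (P :^ k)%G j abD nsDG cD hallP.
- by rewrite -(conjGid Gk) conjSg.
- by rewrite pgroupJ (pHall_pgroup hallP).
(* Frattini argument: [k] is corrected by an element of [D] to [u], which normalises [P]. *)
have eqPd: P :^ k = P :^ d by apply/eqP; rewrite eqEcard sPd !cardJg leqnn.
have Gd: d \in G := subsetP (normal_sub nsDG) d Dd.
pose u := k * d^-1.
have nPu: u \in 'N(P) by apply/normP; rewrite conjsgM eqPd conjsgK.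
have Gu: u \in G by rewrite groupM ?groupV.
have Rkd: [~ k, d^-1] \in R.
  rewrite inE; apply/andP; split.
    by rewrite commgEl groupM ?groupV // memJ_norm // groupV (subsetP nKD).
  by rewrite commgEr groupM ?groupV // memJ_norm ?groupV // (subsetP (normal_norm nsDG)).
(* Modulo [R], [k] and [d^-1] commute, and [d] is a [q']-element, so the [q]-part of [u] agrees with
   [k]. *)
have defk: coset R u.`_q = coset R k.
  have nRu := nR u Gu; have nRk := nR k Gk.
  have nRd: d^-1 \in 'N(R) by rewrite nR ?groupV.
  rewrite morph_constt // morphM // consttM; last first.
    by apply/commgP; rewrite -morphR //= coset_id.
  have ->: (coset R d^-1).`_q = 1.
    apply/constt1P; apply: morph_p_elt => //.
    apply: (mem_p_elt (G := D)); last by rewrite groupV.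
    rewrite /pgroup p'natE //; apply: contra nDq => qD.
    by rewrite mem_primes q_pr cardG_gt0.
  by rewrite mulg1 constt_p_elt //; apply: morph_p_elt.
have nRuq: u.`_q \in 'N(R) by rewrite groupX ?nR.
have nuq: u.`_q \in 'N(R <*> P).
  have suN: <[u.`_q]> \subset 'N(R <*> P).
    by rewrite normsY // cycle_subG // groupX.
  by rewrite -cycle_subG.
have Rk: k * (u.`_q)^-1 \in R.
  have nRk := nR k Gk; apply: coset_idr; first by rewrite groupM ?groupV.
  by rewrite morphM ?groupV //= morphV //= defk mulgV.
rewrite -(mulgKV u.`_q k) groupM //.
by apply: (subsetP (normG _)); apply: (subsetP (joing_subl _ _)).
Qed.

Lemma converse_PsT Hs : complete_Hall_sig_set s G Hs -> PsT s G.
Proof.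
move=> cHs K H qK qH; have [sKH _] := qK; have [sHG _] := qH.
apply: (norm_quasinormal cHs (subset_trans sKH sHG)).
apply: Sylow_sub_full => p p_pr _; have [Q sylQ] := Sylow_exists p D.
exists Q => //; apply/subsetP=> d Qd.
apply: (quasinormal_trans_norm qK qH p_pr); first exact: subsetP (pHall_sub sylQ) d Qd.
exact: mem_p_elt (pHall_pgroup sylQ) Qd.
Qed.

End Converse.

Theorem theoremC (s : nat -> nat) (gT : finGroupType) (G : {group gT}) :
  sig_soluble s G ->
  (exists Hs : {set {group gT}}, gen_Wielandt_sig_set s G Hs) ->
  let D := sig_residual s G in
  PsT s G <->
  ((abelian D /\ Hall G D /\ odd #|D| /\
    (forall x, x \in G -> power_aut_elt x D)) /\
   (forall i, i \in sig_of s #|D| -> special_PsT s (G / Osig s i D)%G)).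
Proof.
move=> solG [Hs [cHs _]]; have [D -> resD] := sig_residualP s G; split.
  move=> pst; have powG := PsT_sig_power (ex_intro _ Hs cHs) pst.
  have nilD := residual_nilpotent solG powG resD.
  split=> [|i _]; last exact: residual_special.
  split; first exact: residual_abelian powG resD nilD.
  split; first exact: residual_Hall powG resD nilD.
  split; first exact: residual_odd powG resD nilD.
  exact: (residual_power powG resD nilD).
move=> [[abD [hallD [_ powD]]] spD].
apply: (converse_PsT (res_normal resD) (res_comm resD) abD hallD _ _ cHs).
  by move=> x Gx A sAD; apply/normP; apply: powD.
by move=> p x d; apply: special_cent.
Qed.
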